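(* Let $n=2s\ge 4$ be even, $k$ an arbitrary field, $X=(X_{ij})$ a generic $n\times(n-1)$ matrix, $R_0=k[X_{ij}]$, and $R=R_0[b_{ij}:1\le i<j\le n]$. Let $\mathbb F$ be the complex $0\to F_3\xrightarrow{d_3}F_2\xrightarrow{d_2}F_1\xrightarrow{d_1}R$ of free modules with bases $\{g\}$ of $F_3$, $\{f_1,\dots,f_n\}$ of $F_2$, $\{e_1,\dots,e_n\}$ of $F_1$ and $d_3(g)=f_n$, $d_2(f_h)=\sum_{j=1}^nX_{jh}e_j$ for $h\le n-1$, $d_2(f_n)=0$, $d_1(e_i)=Y_i$, where $(-1)^{i+1}Y_i$ is the maximal minor of $X$ obtained by deleting row $i$. Then the complex $\mathbb F^{top}_\bullet$ associated to $\mathbb F$ (see context), $$0\to R\xrightarrow{v^{(3)}_{top}}R^n\xrightarrow{v^{(2)}_{top}}R^n\xrightarrow{v^{(1)}_{top}}R,$$ has the following differentials. (1) $v^{(1)}_{top}=(u_1,\dots,u_n)$ with $u_i=\sum_{j\ne i}(-1)^{i+j}Y_jP_{\hat i,\hat j}$. (2) $v^{(2)}_{top}$ is the $n\times n$ matrix whose $(i,h)$ entry is $-\sum_{j=1}^nX_{jh}b_{ij}$ for $1\le h\le n-1$, and whose $(i,n)$ entry is $Y_i$. (3) $v^{(3)}_{top}$ is the column $(v_1,\dots,v_{n-1},P)^T$ with $v_h=(-1)^{h+1}\sum_{1\le i<j\le n}X_{\hat h}^{\hat i,\hat j}P_{\hat i,\hat j}$. Moreover $\mathbb F^{top}_\bullet$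 is acyclic, and it is the minimal free resolution over $R$ of (the quotient of $R$ by) the ideal $J=(u_1,\dots,u_n)$.
   Context: Notation. $b_{ji}=-b_{ij}$, $b_{ii}=0$, and $B=(b_{ij})$ is the resulting generic $n\times n$ skew-symmetric matrix. $P$ is the pfaffian of $B$; for $i<j$, $P_{\hat i,\hat j}$ is the pfaffian of the submatrix of $B$ obtained by deleting rows and columns $i,j$, and $P_{\hat j,\hat i}:=-P_{\hat i,\hat j}$. $X_{\hat h}^{\hat i,\hat j}$ is the minor of $X$ obtained by deleting rows $i,j$ and column $h$. A complex $0\to C_3\to C_2\to C_1\to C_0$ is acyclic if its homology vanishes except at $C_0$. $R$ is a standard graded polynomial ring over $k$; minimal means that all entries of the differentials lie in the ideal generated by all the variables. Definition of $\mathbb F^{top}_\bullet$. All modules are over $R$. (a) For $i<j$ put $e_i\cdot e_j=\alpha_{ij}+b_{ij}f_n$, where $\alpha_{ij}$ is the unique element of $\langle f_1,\dots,f_{n-1}\rangle$ with $d_2(\alpha_{ij})=d_1(e_i)e_j-d_1(e_j)e_i$; put $e_j\cdot e_i=-e_i\cdot e_j$, $e_i\cdot e_i=0$. (b) $e_i\cdot f_h\in F_3$ is the unique element with $d_3(e_i\cdot f_h)=d_1(e_i)f_h-e_i\cdot d_2(f_h)$, where $e_i\cdot\sum_ja_je_j=\sum_ja_j\,e_i\cdot e_j$. (c) For $I=\{i_1<\dots<i_{2t}\}\subseteq\{1,\dots,n\}$ define $v^{(3)}_t(I)\in S_{t-1}F_3\otimes F_2$ recursively. Put $v^{(3)}_1(\{i<j\})=e_i\cdot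 e_j$. For $t\ge2$, $v^{(3)}_t(I)$ is the unique lift, along the injection $S_{t-1}F_3\otimes F_2\to S_{t-2}F_3\otimes S_2F_2$, $g^{t-1}\otimes f\mapsto g^{t-2}\otimes f_nf$, of the image in $S_{t-2}F_3\otimes S_2F_2$ of $\sum_{a=1}^{2t-1}(-1)^{a+1}(e_{i_a}\cdot e_{i_{2t}})\otimes v^{(3)}_{t-1}(I\setminus\{i_a,i_{2t}\})$. (d) For each $i$, let $q_i=\sum_{j<i}(-1)^{j+1}d_1(e_j)v^{(3)}_{s-1}(\{1,\dots,n\}\setminus\{i,j\})+\sum_{j>i}(-1)^{j}d_1(e_j)v^{(3)}_{s-1}(\{1,\dots,n\}\setminus\{i,j\})$, an element of $S_{s-2}F_3\otimes F_2$. It lifts uniquely along $S_{s-1}F_3\to S_{s-2}F_3\otimes F_2$, $g^{s-1}\mapsto g^{s-2}\otimes f_n$. Then: the $h$-th entry of $v^{(3)}_{top}$ is the coefficient of $g^{s-1}\otimes f_h$ in $v^{(3)}_s(\{1,\dots,n\})$; the $(i,h)$ entry of $v^{(2)}_{top}$ is the coefficient of $g$ in $e_i\cdot f_h$; the $i$-th entry of $v^{(1)}_{top}$ is $(-1)^i$ times the coefficient of $g^{s-1}$ in the lift of $q_i$. *)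

(* Defs.v *)
From mathcomp Require Import all_boot all_order all_fingroup all_algebra.
From mathcomp Require Export mpoly.

Set Implicit Arguments.
Unset Strict Implicit.
Unset Printing Implicit Defensive.

Import GRing.Theory.

Local Open Scope ring_scope.

(* Throughout n = m.+1.  Ordinals start at 0, so a sign (-1)^(i+1) indexed     *)
(* from 1 becomes (-1)^i, while (-1)^(i+j) is unchanged.  Elements of free     *)
(* modules are column vectors of coordinates, and maps act by left             *)
(* multiplication.                                                             *)

Section Ideals.
Variables (R : comNzRingType) (I : finType).

Definition in_ideal (a : I -> R) (x : R) : Prop :=
  exists c : I -> R, x = \sum_i c i * a i.

End Ideals.

Section Complexes.
Variable R : comNzRingType.

(* 0 -> R^n3 -> R^n2 -> R^n1 -> R^n0 *)
Definition is_complex n3 n2 n1 n0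
    (d3 : 'M[R]_(n2, n3)) (d2 : 'M[R]_(n1, n2)) (d1 : 'M[R]_(n0, n1)) : Prop :=
  d2 *m d3 = 0 /\ d1 *m d2 = 0.

Definition acyclic n3 n2 n1 n0
    (d3 : 'M[R]_(n2, n3)) (d2 : 'M[R]_(n1, n2)) (d1 : 'M[R]_(n0, n1)) : Prop :=
  [/\ is_complex d3 d2 d1,
      forall z : 'cV[R]_n3, d3 *m z = 0 -> z = 0,
      forall z : 'cV[R]_n2, d2 *m z = 0 -> exists w : 'cV[R]_n3, z = d3 *m w
    & forall z : 'cV[R]_n1, d1 *m z = 0 -> exists w : 'cV[R]_n2, z = d2 *m w].

(* The cokernel of d1 : R^n1 -> R is R/J exactly when the image of d1 is J. *)
Definition free_resolution_of_quotient n3 n2 n1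
    (d3 : 'M[R]_(n2, n3)) (d2 : 'M[R]_(n1, n2)) (d1 : 'M[R]_(1, n1))
    (J : R -> Prop) : Prop :=
  acyclic d3 d2 d1 /\
  forall x : R, J x <-> exists w : 'cV[R]_n1, d1 *m w = x%:M.

End Complexes.

Definition minimal (k : fieldType) (N n3 n2 n1 n0 : nat)
    (d3 : 'M[{mpoly k[N]}]_(n2, n3)) (d2 : 'M[{mpoly k[N]}]_(n1, n2))
    (d1 : 'M[{mpoly k[N]}]_(n0, n1)) : Prop :=
  let irrelevant := in_ideal (fun v : 'I_N => 'X_v : {mpoly k[N]}) in
  [/\ forall i j, irrelevant (d3 i j),
      forall i j, irrelevant (d2 i j)
    & forall i j, irrelevant (d1 i j)].

Section Pfaffian.
Variable R : comNzRingType.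

(* Perfect matchings of {0, ..., N-1} are encoded as fixed-point-free          *)
(* involutions; the sign of a matching is the parity of its crossings          *)
(* i < j < s i < s j.                                                          *)
Definition perfect_matching N (s : 'S_N) : bool :=
  [forall i, (s (s i) == i) && (s i != i)].

Definition crossings N (s : 'S_N) : nat :=
  #|[set p : 'I_N * 'I_N | [&& p.1 < p.2, p.2 < s p.1 & s p.1 < s p.2]%N]|.

Definition pfaffian N (A : 'M[R]_N) : R :=
  \sum_(s : 'S_N | perfect_matching s)
    (-1) ^+ crossings s * \prod_(i < N | (i < s i)%N) A i (s i).

End Pfaffian.

Section Minors.
Variables (R : comNzRingType) (m : nat).
Variables (X : 'M[R]_(m.+1, m)) (B : 'M[R]_m.+1).

Definition signed_minor (i : 'I_m.+1) : R := (-1) ^+ i * \det (row' i X).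

(* For i != j, unlift j i is the position of i once j has been deleted, so     *)
(* the two definitions below delete the rows (and columns) i and j; they are   *)
(* given the value 0 for i = j.                                                *)
Definition minor2 (h : 'I_m) (i j : 'I_m.+1) : R :=
  if unlift j i is Some i' then \det (col' h (row' i' (row' j X))) else 0.

Definition subpfaffian (i j : 'I_m.+1) : R :=
  if unlift j i is Some i'
  then pfaffian (row' i' (row' j (col' i' (col' j B)))) else 0.

Definition pf_hat (i j : 'I_m.+1) : R :=
  if (i < j)%N then subpfaffian i j else - subpfaffian j i.

End Minors.

Section TopComplex.
Variables (R : comNzRingType) (m : nat).

Local Notation F1 := 'cV[R]_m.+1.
Local Notation F2 := 'cV[R]_m.+1.

Definition base_vec (i : 'I_m.+1) : 'cV[R]_m.+1 := delta_mx i 0.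
Definition f_last : F2 := base_vec ord_max.

(* F2 inside Sym(F2), realized as the polynomial ring in f_1, ..., f_n. *)
Definition to_sym (a : F2) : {mpoly R[m.+1]} := \sum_h a h 0 *: 'X_h.

(* The choices made in the construction.  F3 is free on g, hence S_a F3 is     *)
(* free on g^a, and an element of S_a F3, S_a F3 (x) F2 or S_a F3 (x) S_2 F2   *)
(* is given by its coefficient of g^a, which lies in R, F2 or S_2 F2.          *)
Record top_data := TopData {
  alpha : 'I_m.+1 -> 'I_m.+1 -> F2;
  mul_ef : 'I_m.+1 -> 'I_m.+1 -> R;               (* e_i . f_h in F3 *)
  v3 : nat -> {set 'I_m.+1} -> F2;                (* v3 t I in S_(t-1) F3 (x) F2 *)
  q_lift : 'I_m.+1 -> R                           (* in S_(s-1) F3 *)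
}.

Variables (d3 : F2) (d2 : 'M[R]_m.+1) (d1 : 'rV[R]_m.+1) (B : 'M[R]_m.+1).
Variables (s : nat) (D : top_data).

Definition mul_ee (i j : 'I_m.+1) : F2 :=
  if (i < j)%N then alpha D i j + B i j *: f_last
  else if (j < i)%N then - (alpha D j i + B j i *: f_last)
  else 0.

Definition mul_e (i : 'I_m.+1) (a : F1) : F2 := \sum_j a j 0 *: mul_ee i j.

(* For I = {i_1 < ... < i_2t} and i = i_a, this is a - 1. *)
Definition pos (I : {set 'I_m.+1}) (i : 'I_m.+1) : nat :=
  #|[set j in I | (j < i)%N]|.

Definition q (i : 'I_m.+1) : F2 :=
  \sum_(j < m.+1 | (j < i)%N)
     ((-1) ^+ j * d1 0 j) *: v3 D s.-1 (~: [set i; j]) +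
  \sum_(j < m.+1 | (i < j)%N)
     ((-1) ^+ j.+1 * d1 0 j) *: v3 D s.-1 (~: [set i; j]).

Record is_top_data : Prop := IsTopData {
  alphaP : forall i j : 'I_m.+1, (i < j)%N ->
    unique (fun a : F2 => a ord_max 0 = 0 /\
              d2 *m a = d1 0 i *: base_vec j - d1 0 j *: base_vec i)
           (alpha D i j);
  mul_efP : forall i h : 'I_m.+1,
    unique (fun c : R => c *: d3 =
              d1 0 i *: base_vec h - mul_e i (d2 *m base_vec h))
           (mul_ef D i h);
  v3_1P : forall i j : 'I_m.+1, (i < j)%N -> v3 D 1 [set i; j] = mul_ee i j;
  v3P : forall (t : nat) (I : {set 'I_m.+1}) (l : 'I_m.+1),
    (2 <= t)%N -> #|I| = t.*2 -> l \in I -> {in I, forall i : 'I_m.+1, (i <= l)%N} ->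
    unique (fun w : F2 => 'X_ord_max * to_sym w =
              \sum_(i in I :\ l) (-1) ^+ pos I i *:
                 (to_sym (mul_ee i l) * to_sym (v3 D t.-1 (I :\ i :\ l))))
           (v3 D t I);
  q_liftP : forall i : 'I_m.+1,
    unique (fun c : R => c *: f_last = q i) (q_lift D i)
}.

Definition v3_top : 'cV[R]_m.+1 := v3 D s [set: 'I_m.+1].
Definition v2_top : 'M[R]_m.+1 := \matrix_(i, h) mul_ef D i h.
Definition v1_top : 'rV[R]_m.+1 := \row_i ((-1) ^+ i.+1 * q_lift D i).

End TopComplex.

Section Generic.
Variables (k : fieldType) (m : nat).

(* The variables X_ij, and b_ij for i < j. *)
Definition gen_var : finType :=
  ('I_m.+1 * 'I_m + {p : 'I_m.+1 * 'I_m.+1 | (p.1 < p.2)%N})%type.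

Definition gen_ring : comNzRingType := {mpoly k[#|gen_var|]}.

Definition var (v : gen_var) : gen_ring := 'X_(enum_rank v).

Definition genX : 'M[gen_ring]_(m.+1, m) := \matrix_(i, j) var (inl (i, j)).

Definition b_var (i j : 'I_m.+1) : gen_ring :=
  if insub (i, j) is Some p then var (inr p) else 0.

Definition genB : 'M[gen_ring]_m.+1 := \matrix_(i, j) (b_var i j - b_var j i).

Definition Y (i : 'I_m.+1) : gen_ring := signed_minor genX i.

Definition d1 : 'rV[gen_ring]_m.+1 := \row_i Y i.

Definition d2 : 'M[gen_ring]_m.+1 :=
  \matrix_(j, h) if unlift ord_max h is Some h' then genX j h' else 0.

Definition d3 : 'cV[gen_ring]_m.+1 := f_last gen_ring m.

Definition u (i : 'I_m.+1) : gen_ring :=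
  \sum_(j < m.+1 | j != i) (-1) ^+ (i + j) * Y j * pf_hat genB i j.

Definition v (h : 'I_m) : gen_ring :=
  (-1) ^+ h * \sum_(i < m.+1) \sum_(j < m.+1 | (i < j)%N)
                minor2 genX h i j * pf_hat genB i j.

End Generic.

(* Main.v *)
From HB Require Import structures.
Require Import Defs.
From mathcomp Require Import all_boot all_order all_fingroup all_algebra.
From mathcomp Require Import ring zify.

Set Implicit Arguments.
Unset Strict Implicit.
Unset Printing Implicit Defensive.

Import GRing.Theory.

Local Open Scope ring_scope.

(** The construction has a closed form. Let [A h i j] be the cofactor
    [bordered_minor] of [X] bordered by the unit column of index [j]. By
    Cramer's rule, [X] sends the column of the [A h i j] to Y_i e_j - Y_j e_i,
    so this column is alpha_ij. The element v_t(I) then has last coordinate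
    Pf(B_I), and its coordinate of index h is the derivative of Pf(B_I) in the
    direction of the alternating matrix [A h]. In other words it is
    the Pfaffian on I of f_n B + sum_h f_h (A h), divided by f_n^(t-1). That the
    division is possible, the content of the recursion, is due to the identity
    Y_p (A h) = Y /\ A h p: all the [A h] share the factor Y, and a
    decomposable perturbation contributes to the Pfaffian to first order only
    ([pfs_recursion2], [pfs_recursion1], [pfs_recursion0]). Evaluating at the
    full set of indices gives the three differentials.

    Signs are handled by contractions [contr a], which are the interior products
    of the exterior algebra, acting on functions of finite sets of indices.
    Expansion of the Pfaffian along row k says that contracting by this row
    amounts to inserting k into the set ([contr_pfs]); together with the
    canonical anticommutation relation [ins_contr] it yields every Pfaffian
    identity below.

    For acyclicity, write P for the Pfaffian adjoint of B, so that
    B P = P B = Pf and u = P Y. If u.y = 0 then P y is orthogonal to Y, hence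
    P y = X z by the Hilbert-Burch theorem. Modulo Pf, the vectors u and P y are
    both killed by B and orthogonal to Y, hence proportional ([corank_one]);
    as Pf, u_2, u_0 is a regular sequence, P y = c u modulo Pf. Since u = X v
    and X stays injective modulo Pf, z = c v + Pf z'', and cancelling P in
    P y = c P Y + P B X z'' puts y in the image of (-B X, Y)
    ([top_exact1]). The kernel of (-B X, Y) is found in the same way
    ([top_exact2]), and the last map is injective because Pf is nonzero.

    The regular sequences come from a perturbation. Adding to X and B matrices
    of linear forms in three new variables y, sg, tau embeds the generic ring as
    a retract of a polynomial ring over itself, and regularity descends along
    retracts ([nzd_mod_retract]). There regularity may be checked on the parts of
    highest degree ([nzd_mod_top], [nzd_mod2_top]), and the perturbing matrices
    are chosen so that these parts are triangular: up to sign, a power of y for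
    Pf, a power of sg modulo y for u_2, and a power of tau modulo y and sg for
    u_0. *)

(** * Contractions of functions of finite sets *)

Section Contraction.
Variables (R : comNzRingType) (n : nat).
Implicit Types (I : {set 'I_n}) (i j k : 'I_n) (a b : 'I_n -> R).
Implicit Types F G : {set 'I_n} -> R.

Definition rank_in I i : nat := #|[set j in I | (j < i)%N]|.

Lemma rank_inD1 I i j : i \in I ->
  rank_in I j = ((i < j) + rank_in (I :\ i) j)%N.
Proof.
move=> iI; rewrite /rank_in.
rewrite (cardsD1 i) !inE iI /=; congr (_ + _)%N.
by apply: eq_card => x; rewrite !inE andbA.
Qed.

(** The transpose of the interior product by [a], when [F] is read as the linear
    form on the exterior algebra with value [F I] on the basis vector [e_I]. *)
Definition contr a F I : R := \sum_(i in I) (-1) ^+ rank_in I i * a i * F (I :\ i).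

(** The transpose of the exterior product by the basis vector [e_k]. *)
Definition ins k F I : R :=
  if k \in I then 0 else (-1) ^+ rank_in I k * F (k |: I).

Definition rem_sign I i j : R := (-1) ^+ (rank_in I i + rank_in (I :\ i) j).

(** Removing two elements of [I] in either order gives opposite signs. *)
Lemma rem_signC I i j : i \in I -> j \in I -> i != j ->
  rem_sign I i j = - rem_sign I j i.
Proof.
move=> iI jI ij; rewrite /rem_sign (rank_inD1 j iI) (rank_inD1 i jI).
rewrite !exprD; case: (ltngtP i j) => [lt|lt|/val_inj e]; last by rewrite e eqxx in ij.
  by rewrite ?lt ?(leq_gtF (ltnW lt)) /= ?expr0 ?expr1; ring.
by rewrite ?lt ?(leq_gtF (ltnW lt)) /= ?expr0 ?expr1; ring.
Qed.

(** Terms are cancelled in pairs rather than by halving, so that characteristic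
    two is included. *)
Lemma alternating_sum I (f : 'I_n -> 'I_n -> R) :
  (forall i j, i \in I -> j \in I -> i != j -> f i j = - f j i) ->
  \sum_(i in I) \sum_(j in I :\ i) f i j = 0.
Proof.
move=> fN.
have -> : \sum_(i in I) \sum_(j in I :\ i) f i j =
   \sum_(i in I) \sum_(j in I | (j < i)%N) f i j
   + \sum_(i in I) \sum_(j in I | (i < j)%N) f i j.
  rewrite -big_split; apply: eq_bigr => i iI /=.
  rewrite (bigID (fun j : 'I_n => (j < i)%N)) /=; congr (_ + _); apply: eq_bigl => j;
    rewrite !inE -val_eqE; case: (j \in I); rewrite ?andbF //= ?andbT; by case: ltngtP.
rewrite [X in X + _](exchange_big_dep (fun j => j \in I)) //=; last by move=> i j _ /andP[].
rewrite -big_split big1 // => i iI /=; rewrite -[X in _ + X]opprK -sumrN.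
apply/eqP; rewrite subr_eq0; apply/eqP.
rewrite (eq_bigl (fun j => (j \in I) && (i < j)%N)); last by move=> j; rewrite iI /=.
apply: eq_bigr => j /andP[jI lt]; rewrite fN //.
by rewrite -val_eqE neq_ltn lt orbT.
Qed.

Lemma contr2E a b F I : contr a (contr b F) I =
  \sum_(i in I) \sum_(j in I :\ i) rem_sign I i j * (a i * b j) * F (I :\ i :\ j).
Proof.
apply: eq_bigr => i iI; rewrite mulr_sumr; apply: eq_bigr => j jI.
rewrite /rem_sign exprD; ring.
Qed.

Lemma setD1C I i j : I :\ i :\ j = I :\ j :\ i.
Proof. by apply/setP => x; rewrite !inE andbCA. Qed.

Lemma contr_nilp a F I : contr a (contr a F) I = 0.
Proof.
rewrite contr2E; apply: alternating_sum => i j iI jI ij.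
by rewrite (rem_signC iI jI ij) setD1C; ring.
Qed.

Lemma contr_anticomm a b F I : contr a (contr b F) I = - contr b (contr a F) I.
Proof.
rewrite !contr2E (exchange_big_dep (fun j => j \in I)) /=; last by move=> i j _ /setD1P[].
rewrite -sumrN; apply: eq_bigr => j jI; rewrite -sumrN.
apply: eq_big => [i|i /andP[iI /setD1P[ji _]]].
  by rewrite !inE jI andbT eq_sym andbC.
by rewrite rem_signC ?[i == j]eq_sym // setD1C; ring.
Qed.

(** Canonical anticommutation relation; the sign of inserting [k] after removing
    [i] is opposite to that of the other order by [rem_signC]. *)
Lemma ins_contr k a F I : ins k (contr a F) I + contr a (ins k F) I = a k * F I.
Proof.
rewrite /ins; case: ifPn => kI.
  rewrite add0r /contr (bigD1 k) //= big1 => [|i /andP[iI ik]]; last first.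
    by rewrite !inE eq_sym ik kI mulr0.
  rewrite !inE eqxx /= setD1K // addr0.
  have -> : rank_in (I :\ k) k = rank_in I k by rewrite (rank_inD1 k kI) ltnn.
  by rewrite -!mulrA mulrCA signrMK.
rewrite /contr big_setU1 //= setU1K // mulrDr.
have kin : k \in k |: I by rewrite setU11.
have -> : rank_in (k |: I) k = rank_in I k by rewrite (rank_inD1 k kin) ltnn setU1K.
rewrite -!mulrA signrMK -addrA -[RHS]addr0; congr (_ + _).
rewrite mulr_sumr -big_split big1 // => i iI /=.
have ik : i != k by apply: contraNneq kI => <-.
have iin : i \in k |: I by rewrite !inE iI orbT.
have -> : k |: I :\ i = (k |: I) :\ i.
  by apply/setP => x; rewrite !inE; case: eqP => // ->; rewrite eq_sym (negPf ik).
rewrite !inE eq_sym (negPf ik) (negPf kI) /=.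
have := rem_signC kin iin; rewrite eq_sym => /(_ ik).
rewrite /rem_sign setU1K // !exprD.
have -> : rank_in (k |: I) k = rank_in I k by rewrite (rank_inD1 k kin) ltnn setU1K.
have -> : rank_in ((k |: I) :\ i) k = rank_in (I :\ i) k.
  have kin' : k \in (k |: I) :\ i by rewrite !inE eqxx eq_sym ik.
  rewrite (rank_inD1 _ kin') ltnn; congr (rank_in _ _); rewrite setD1C setU1K //.
rewrite (rank_inD1 i kin) setU1K // exprD => E.
have S2 : ((-1) ^+ (k < i)%N * (-1) ^+ (k < i)%N = 1 :> R) by rewrite -expr2 sqrr_sign.
move: S2 E; move: ((-1) ^+ (k < i)%N) ((-1) ^+ rank_in I k) ((-1) ^+ rank_in I i)
  ((-1) ^+ rank_in (I :\ i) k) (a i) (F _) => w x y z c f S2 E.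
ring: S2 E.
Qed.

End Contraction.

(** * Pfaffians of principal submatrices *)

Section SetPfaffian.
Variables (R : comNzRingType) (n : nat).
Implicit Types (I K : {set 'I_n}) (i j k a b : 'I_n) (s : 'S_n).
Implicit Type A : 'M[R]_n.

(** Matchings of [I] are encoded as involutions of the whole index set whose set
    of moved points is [I]: all principal Pfaffians are then sums over the same
    group, without reindexing. *)
Definition matching_on I s : bool :=
  [forall i, s (s i) == i] && ([set i | s i != i] == I).

Definition matching_weight A s : R :=
  (-1) ^+ crossings s * \prod_(i < n | (i < s i)%N) A i (s i).

Definition pfs A I : R := \sum_(s | matching_on I s) matching_weight A s.

Lemma matching_onP I s :
  reflect ((forall i, s (s i) = i) /\ (forall i, (i \in I) = (s i != i))) (matching_on I s).
Proof.
apply: (iffP andP) => [[/forallP h1 /eqP <-]|[h1 h2]]; split.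
- by move=> i; apply/eqP.
- by move=> i; rewrite inE.
- by apply/forallP => i; rewrite h1.
- by apply/eqP/setP => i; rewrite inE h2.
Qed.

Lemma pfaffianE A : pfaffian A = pfs A setT.
Proof.
apply: eq_bigl => s; apply/idP/idP.
  move/forallP=> h; apply/matching_onP; split=> i; case/andP: (h i) => /eqP h1 h2 //.
  by rewrite inE h2.
by case/matching_onP=> h1 h2; apply/forallP => i; rewrite h1 eqxx -h2 inE.
Qed.

Lemma pfs0 A : pfs A set0 = 1.
Proof.
rewrite /pfs (big_pred1 1%g) => [|s]; last first.
  apply/matching_onP/eqP => [[_ h]|->]; last by split=> i; rewrite !perm1 ?inE ?eqxx.
  by apply/permP => i; rewrite perm1; have := h i; rewrite inE; case: eqP.
rewrite /matching_weight big1 => [|i]; last by rewrite perm1 ltnn.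
rewrite mulr1 /crossings (_ : [set p | _] = set0) ?cards0 //.
by apply/setP => p; rewrite !inE !perm1; case: ltngtP => //= ->; rewrite ?andbF.
Qed.

(** The points below their image and the points above it correspond under [s]. *)
Lemma card_involution (I : {set 'I_n}) s : (forall i, s (s i) = i) ->
  {in I, forall i, (s i \in I) && (s i != i)} -> odd #|I| = false.
Proof.
move=> sK sI.
rewrite -(cardsID [set i : 'I_n | (i < s i)%N] I).
have -> : I :\: [set i : 'I_n | (i < s i)%N] = s @: (I :&: [set i : 'I_n | (i < s i)%N]).
  apply/setP => x; apply/idP/imsetP => [|[y]].
    rewrite !inE -leqNgt => /andP[le xI]; exists (s x); last by rewrite sK.
    have /andP[h1 h2] := sI x xI; rewrite !inE h1 sK /= ltn_neqAle le andbT.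
    by rewrite -val_eqE in h2.
  rewrite !inE => /andP[yI lt] ->; rewrite sK -leqNgt (ltnW lt) /=.
  by case/andP: (sI y yI).
by rewrite card_imset; [rewrite addnn odd_double | exact: perm_inj].
Qed.

(** A new pair [a < b] crosses exactly the pairs with one point between [a] and
    [b], and pairs with both points there do not change the parity of the number
    of matched points between them. *)
Lemma crossings_swap I a b s : (a < b)%N -> matching_on I s ->
  a \notin I -> b \notin I ->
  (-1) ^+ crossings (s * tperm a b) =
  (-1) ^+ #|[set x in I | (a < x < b)%N]| * (-1) ^+ crossings s :> R.
Proof.
move=> ab /matching_onP[sK sI] aI bI.
have sa : s a = a by apply/eqP; move: aI; rewrite sI negbK.
have sb : s b = b by apply/eqP; move: bI; rewrite sI negbK.
set s1 := (s * tperm a b)%g.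
have s1a : s1 a = b by rewrite permM sa tpermL.
have s1b : s1 b = a by rewrite permM sb tpermR.
have s1x x : x != a -> x != b -> s1 x = s x.
  move=> xa xb; rewrite permM tpermD //; apply/eqP => e.
    by case/eqP: xa; rewrite -(sK x) -e sa.
  by case/eqP: xb; rewrite -(sK x) -e sb.
(* C: crossings of s; L, G, M: matched points between a and b whose partner lies
   below a, above b, or between them. *)
pose C := [set p : 'I_n * 'I_n | [&& p.1 < p.2, p.2 < s p.1 & s p.1 < s p.2]%N].
pose L := [set x in I | (a < x < b)%N & (s x < a)%N].
pose G := [set x in I | (a < x < b)%N & (b < s x)%N].
pose M := [set x in I | (a < x < b)%N & (a < s x < b)%N].
have split_btw : #|[set x in I | (a < x < b)%N]| = (#|L| + #|G| + #|M|)%N.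
  rewrite -cardsUI (_ : L :&: G = set0); last first.
    apply/setP => x; rewrite !inE; apply/negbTE/negP => /andP[/and3P[_ _ h1] /and3P[_ _ h2]].
    by have := ltn_trans h2 (ltn_trans h1 ab); rewrite ltnn.
  rewrite cards0 addn0 -cardsUI (_ : (L :|: G) :&: M = set0); last first.
    apply/setP => x; rewrite !inE; apply/negbTE/negP => /andP[].
    move=> /orP[] /and3P[_ _ h1] /and3P[_ _ /andP[h2 h3]].
      by have := ltn_trans h1 h2; rewrite ltnn.
    by have := ltn_trans h1 h3; rewrite ltnn.
  rewrite cards0 addn0; apply: eq_card => x; rewrite !inE.
  case xI: (x \in I) => //=; case: (a < x < b)%N => //=.
  case: (ltngtP (s x) a) => // [lt|/val_inj e]; last first.
    by move: aI; rewrite -e sI sK eq_sym -sI xI.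
  case: (ltngtP (s x) b) => // /val_inj e.
  by move: bI; rewrite -e sI sK eq_sym -sI xI.
have oddM : odd #|M| = false.
  apply: (@card_involution M s sK) => x; rewrite !inE sK => /and3P[xI -> ->].
  by rewrite sI sK eq_sym -sI xI.
have -> : crossings s1 = (#|C| + (#|G| + #|L|))%N.
  have inj1 : injective (fun x : 'I_n => (a, x)) by move=> x y [].
  have inj2 : injective (fun x : 'I_n => (s x, a)) by move=> x y [] /perm_inj.
  rewrite -(card_imset G inj1) -(card_imset L inj2) -cardsUI.
  rewrite [X in (_ + (_ + X))%N](_ : _ = 0%N) ?addn0; last first.
    apply/eqP; rewrite cards_eq0; apply/eqP/setP => p; rewrite !inE.
    apply/negbTE/negP => /andP[/imsetP[x _ ->] /imsetP[y]].
    by rewrite !inE => /and3P[_ _ h] [e _]; rewrite -e ltnn in h.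
  rewrite -cardsUI.
  rewrite [X in (_ + X)%N](_ : _ = 0%N) ?addn0; last first.
    apply/eqP; rewrite cards_eq0; apply/eqP/setP => p; rewrite !inE.
    apply/negbTE/negP => /andP[/and3P[h1 h2 h3] /orP[] /imsetP[y _ e]].
      by move: h1 h2; rewrite e /= sa => h; rewrite ltnNge (ltnW h).
    by move: h2 h3; rewrite e /= sa => h; rewrite ltnNge (ltnW h).
  rewrite /crossings; apply: eq_card => -[x y].
  rewrite !inE /=; apply/and3P/orP => [[xy ys ss]|].
    case: (x =P a) => [xa|/eqP xa].
      right; apply/orP; left; apply/imsetP; exists y; rewrite ?xa //.
      move: xy ys ss; rewrite xa s1a => h1 h2.
      rewrite s1x; [|by rewrite -val_eqE gtn_eqF|by rewrite -val_eqE ltn_eqF].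
      rewrite !inE h1 h2 => h3 /=; rewrite h3 andbT sI.
      by rewrite -val_eqE gtn_eqF // (ltn_trans h2).
    have xb : x != b.
      apply: contraTneq (ltn_trans xy ys) => ->; rewrite s1b.
      by rewrite -leqNgt ltnW.
    rewrite s1x // in ys ss.
    case: (y =P a) => [ya|/eqP ya].
      right; apply/orP; right; apply/imsetP; exists (s x); rewrite ?sK ?ya //.
      have xsx : x != s x by rewrite -val_eqE ltn_eqF // (ltn_trans xy ys).
      move: xy ys ss; rewrite ya s1a !inE sK => -> -> ->.
      by rewrite !andbT sI sK.
    have yb : y != b.
      by apply: contraTneq (ltn_trans ys ss) => ->; rewrite s1b -leqNgt ltnW.
    by left; apply/and3P; split; rewrite // -(s1x y).
  case=> [/and3P[h1 h2 h3]|/orP[] /imsetP[z]].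
    have xa : x != a by apply: contraTneq (ltn_trans h1 h2) => ->; rewrite sa ltnn.
    have xb : x != b by apply: contraTneq (ltn_trans h1 h2) => ->; rewrite sb ltnn.
    have ya : y != a by apply: contraTneq (ltn_trans h2 h3) => ->; rewrite sa ltnn.
    have yb : y != b by apply: contraTneq (ltn_trans h2 h3) => ->; rewrite sb ltnn.
    by rewrite !s1x.
  - rewrite !inE => /and3P[zI /andP[h1 h2] h3] [-> ->]; rewrite s1a s1x //.
      by rewrite -val_eqE gtn_eqF.
    by rewrite -val_eqE ltn_eqF.
  rewrite !inE => /and3P[zI /andP[h1 h2] h3] [-> ->]; rewrite s1a s1x ?sK //.
    by rewrite -val_eqE ltn_eqF.
  by rewrite -val_eqE ltn_eqF // (ltn_trans h3).
rewrite split_btw -/C -[in RHS]signr_odd !oddD oddM addbF /crossings -/C !exprD.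
by rewrite addbC -oddD signr_odd exprD mulrC.
Qed.

Lemma weight_swap A I a b s : (a < b)%N -> matching_on I s ->
  a \notin I -> b \notin I ->
  matching_weight A (s * tperm a b) =
  (-1) ^+ #|[set x in I | (a < x < b)%N]| * A a b * matching_weight A s.
Proof.
move=> ab mI aI bI; rewrite /matching_weight (crossings_swap ab mI) //.
case/matching_onP: mI => sK sI.
have sa : s a = a by apply/eqP; move: aI; rewrite sI negbK.
have sb : s b = b by apply/eqP; move: bI; rewrite sI negbK.
rewrite (bigD1 a) /= permM sa tpermL //= -!mulrA; congr (_ * _).
rewrite [RHS]mulrCA; congr (_ * (_ * _)).
have s1x x : x != a -> x != b -> (s * tperm a b)%g x = s x.
  move=> xa xb; rewrite permM tpermD //; apply/eqP => e.
    by case/eqP: xa; rewrite -(sK x) -e sa.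
  by case/eqP: xb; rewrite -(sK x) -e sb.
apply: eq_big => [x|x /andP[lt xa]].
  case: (eqVneq x a) => [->|xa]; first by rewrite sa ltnn andbF.
  case: (eqVneq x b) => [->|xb]; last by rewrite s1x // andbT.
  by rewrite permM sb tpermR ltnn ltnNge (ltnW ab).
rewrite s1x //; apply: contraTneq lt => ->.
by rewrite permM sb tpermR -leqNgt ltnW.
Qed.

(** Composing with a transposition adds or removes the pair [k, j]: this is the
    bijection behind the expansion of the Pfaffian along row [k]. *)
Lemma matching_swap K k j s : k \in K -> j \in K -> k != j ->
  matching_on K (s * tperm k j) && ((s * tperm k j)%g k == j) =
  matching_on (K :\ k :\ j) s.
Proof.
move=> kK jK kj; apply/andP/idP => [[/matching_onP[tK tI] /eqP tk]|/matching_onP[sK sI]].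
  have sE x : s x = tperm k j ((s * tperm k j)%g x) by rewrite permM tpermK.
  move: tK tI tk sE; move: (s * tperm k j)%g => t tK tI tk sE.
  have tj : t j = k by rewrite -tk tK.
  have sk : s k = k by rewrite sE tk tpermR.
  have sj : s j = j by rewrite sE tj tpermL.
  have sx x : x != k -> x != j -> s x = t x.
    move=> xk xj; rewrite sE tpermD //; apply/eqP => e.
      by case/eqP: xj; rewrite -(tK x) -e.
    by case/eqP: xk; rewrite -(tK x) -e.
  apply/matching_onP; split=> x.
    case: (eqVneq x k) => [->|xk]; first by rewrite !sk.
    case: (eqVneq x j) => [->|xj]; first by rewrite !sj.
    rewrite (sx x) // sx ?tK //; apply/eqP => e.
      by case/eqP: xj; rewrite -(tK x) e.
    by case/eqP: xk; rewrite -(tK x) e.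
  rewrite !inE tI.
  case: (eqVneq x j) => [->|xj]; first by rewrite sj eqxx.
  case: (eqVneq x k) => [->|xk]; first by rewrite sk eqxx.
  by rewrite sx.
have sk : s k = k by apply/eqP; have := sI k; rewrite !inE eqxx andbF => /esym/negbFE.
have sj : s j = j by apply/eqP; have := sI j; rewrite !inE eqxx => /esym/negbFE.
have tk : (s * tperm k j)%g k = j by rewrite permM sk tpermL.
have tj : (s * tperm k j)%g j = k by rewrite permM sj tpermR.
have tx x : x != k -> x != j -> (s * tperm k j)%g x = s x.
  move=> xk xj; rewrite permM tpermD //; apply/eqP => e.
    by case/eqP: xk; rewrite -(sK x) -e sk.
  by case/eqP: xj; rewrite -(sK x) -e sj.
split; last by rewrite tk.
apply/matching_onP; split=> x.
  case: (eqVneq x k) => [->|xk]; first by rewrite tk tj.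
  case: (eqVneq x j) => [->|xj]; first by rewrite tj tk.
  rewrite (tx x) // tx ?sK //; apply/eqP => e.
    by case/eqP: xk; rewrite -(sK x) e.
  by case/eqP: xj; rewrite -(sK x) e.
case: (eqVneq x k) => [->|xk]; first by rewrite tk kK eq_sym kj.
case: (eqVneq x j) => [->|xj]; first by rewrite tj jK kj.
by rewrite tx // -sI !inE xk xj.
Qed.

(** Skew-symmetric with zero diagonal, which skew-symmetry does not imply in
    characteristic two. *)
Definition alternating_mx A := (forall i, A i i = 0) /\ (forall i j, A j i = - A i j).

(** Expansion along row [k]: sort the matchings of [K] by the partner of [k]. *)
Lemma pfs_expand A K k : alternating_mx A -> k \in K ->
  pfs A K = (-1) ^+ rank_in K k * contr (A k) (pfs A) (K :\ k).
Proof.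
move=> [A0 AN] kK; rewrite /pfs (partition_big (fun s => s k) (mem (K :\ k))) /=; last first.
  move=> s /matching_onP[sK sI]; rewrite !inE -sI kK sI sK eq_sym -sI kK.
  by [].
rewrite /contr mulr_sumr; apply: eq_bigr => j jK.
have /andP[jk jK'] : (j != k) && (j \in K) by move: jK; rewrite !inE.
have kj : k != j by rewrite eq_sym.
rewrite (reindex_onto (fun s => s * tperm k j)%g (fun s => s * tperm k j)%g) /=; last first.
  by move=> s _; rewrite -mulgA tperm2 mulg1.
rewrite !mulr_sumr; apply: eq_big => [s|s].
  by rewrite matching_swap // -mulgA tperm2 mulg1 eqxx andbT.
rewrite matching_swap // => /andP[ms _].
have btwE (a b : 'I_n) : (a < b)%N -> a \in K -> b \in K ->
  rank_in K b = (rank_in K a + #|[set x in K :\ a :\ b | (a < x < b)%N]|).+1.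
  move=> ab aK bK; rewrite (rank_inD1 b aK) ab add1n /rank_in.
  rewrite -(cardsID [set x : 'I_n | (x < a)%N]); congr (_ + _).+1.
    apply: eq_card => x; rewrite !inE -!val_eqE /=.
    case: (ltngtP x a) => lt; rewrite ?andbF //= !andbT.
    by rewrite (ltn_trans lt ab) andbT.
  apply: eq_card => x; rewrite !inE -leqNgt -!val_eqE /=.
  by case: (ltngtP x a) => lt; case: (ltngtP x b); rewrite ?andbF ?andbT.
case: (ltngtP k j) => [lt|lt|/val_inj e]; last by rewrite e eqxx in kj.
  rewrite (weight_swap A lt ms) ?inE ?eqxx ?andbF // !mulrA; congr (_ * _ * _).
  have := rank_inD1 j kK; rewrite lt (btwE _ _ lt kK jK') add1n => -[<-].
  by rewrite exprD signrMK.
rewrite tpermC (weight_swap A lt ms) ?inE ?eqxx ?andbF //.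
have := rank_inD1 j kK; rewrite ltnNge (ltnW lt) add0n => <-.
rewrite (AN j k) (btwE _ _ lt jK' kK) setD1C exprS exprD.
have S2 : (-1) ^+ rank_in K j * (-1) ^+ rank_in K j = 1 :> R by rewrite -expr2 sqrr_sign.
by move: S2; move: ((-1) ^+ _) ((-1) ^+ _) => x y S2; ring: S2.
Qed.

End SetPfaffian.

Section ContractionPfaffian.
Variables (R : comNzRingType) (n : nat).
Implicit Types (I J K : {set 'I_n}) (i j k l : 'I_n) (a b w : 'I_n -> R).
Implicit Types (A B : 'M[R]_n) (F G : {set 'I_n} -> R).

Definition unit_fun k : 'I_n -> R := fun i => (i == k)%:R.

Lemma eq_contr a F G I : (forall i, i \in I -> F (I :\ i) = G (I :\ i)) ->
  contr a F I = contr a G I.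
Proof. by move=> e; apply: eq_bigr => i iI; rewrite e. Qed.

Lemma eq_contr_coef a b F I : {in I, a =1 b} -> contr a F I = contr b F I.
Proof. by move=> e; apply: eq_bigr => i iI; rewrite e. Qed.

Lemma contr_unit k F I :
  contr (unit_fun k) F I = if k \in I then (-1) ^+ rank_in I k * F (I :\ k) else 0.
Proof.
rewrite /contr /unit_fun; case: ifPn => kI.
  rewrite (bigD1 k) //= eqxx mulr1 big1 ?addr0 // => i /andP[_ /negPf ->].
  by rewrite mulr0 mul0r.
rewrite big1 // => i iI; case: eqP => [e|]; last by rewrite mulr0 mul0r.
by rewrite -e iI in kI.
Qed.

Lemma contr0 a F I : (forall J, F J = 0) -> contr a F I = 0.
Proof. by move=> F0; apply: big1 => i _; rewrite F0 mulr0. Qed.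

Lemma contrN a F I : contr a (fun J => - F J) I = - contr a F I.
Proof. by rewrite /contr -sumrN; apply: eq_bigr => i _; rewrite mulrN. Qed.

Lemma contrD a F G I : contr a (fun J => F J + G J) I = contr a F I + contr a G I.
Proof. by rewrite /contr -big_split; apply: eq_bigr => i _; rewrite mulrDr. Qed.

Lemma contrZ a c F I : contr a (fun J => c * F J) I = c * contr a F I.
Proof. by rewrite /contr mulr_sumr; apply: eq_bigr => i _; ring. Qed.

Lemma contr_lin (T : finType) (c : T -> R) (a : T -> 'I_n -> R) F I :
  contr (fun i => \sum_t c t * a t i) F I = \sum_t c t * contr (a t) F I.
Proof.
rewrite /contr; under [RHS]eq_bigr => t _ do rewrite mulr_sumr.
rewrite exchange_big /=; apply: eq_bigr => i iI.
rewrite mulr_sumr mulr_suml; apply: eq_bigr => t _; ring.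
Qed.

Lemma contr_combZ c a F I : contr (fun i => c * a i) F I = c * contr a F I.
Proof. by rewrite /contr mulr_sumr; apply: eq_bigr => i _; ring. Qed.

Lemma contr_combB a b F I :
  contr (fun i => a i - b i) F I = contr a F I - contr b F I.
Proof. by rewrite /contr -sumrB; apply: eq_bigr => i _; ring. Qed.

(** For [k] outside [I] this is [pfs_expand]. For [k] in [I] it says that a
    Pfaffian with a repeated row vanishes: every term is expanded along row [k]
    once more, and a contraction has square zero. *)
Lemma contr_pfs A k I : alternating_mx A ->
  contr (A k) (pfs A) I = ins k (pfs A) I.
Proof.
move=> altA; rewrite /ins; case: ifPn => kI; last first.
  rewrite (pfs_expand altA (setU11 k I)) setU1K //.
  by rewrite (rank_inD1 k (setU11 k I)) setU1K // ltnn signrMK.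
have -> : contr (A k) (pfs A) I =
    contr (A k) (contr (unit_fun k) (contr (A k) (pfs A))) I.
  apply: eq_bigr => i iI; have [->|ik] := eqVneq i k.
    by rewrite altA.1 !mulr0 !mul0r.
  have kIi : k \in I :\ i by rewrite !inE eq_sym ik.
  by rewrite contr_unit kIi -pfs_expand.
rewrite contr_anticomm contr0 ?oppr0 // => J; exact: contr_nilp.
Qed.

(** With [pfs_isolated], the Pfaffian of a sparse matrix is computed by stripping
    the leaves of its graph; only the value up to sign is ever needed. *)
Lemma pfs_leaf A K k j : alternating_mx A -> k \in K -> j \in K -> j != k ->
  {in K, forall x, x != j -> A k x = 0} ->
  exists e : bool, pfs A K = (-1) ^+ e * A k j * pfs A (K :\ k :\ j).
Proof.
move=> altA kK jK jk A0.
exists (odd (rank_in K k) (+) odd (rank_in (K :\ k) j)).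
rewrite (pfs_expand altA kK) /contr (bigD1 j) /=; last by rewrite !inE jk.
rewrite big1 ?addr0 => [|x /andP[/setD1P[_ xK] xj]]; last by rewrite A0 // mulr0 mul0r.
by rewrite signr_addb !signr_odd !mulrA.
Qed.

Lemma pfs_isolated A K k : alternating_mx A -> k \in K ->
  {in K, forall x, A k x = 0} -> pfs A K = 0.
Proof.
move=> altA kK A0; rewrite (pfs_expand altA kK) /contr big1 ?mulr0 // => x.
by case/setD1P=> _ xK; rewrite A0 // mulr0 mul0r.
Qed.

End ContractionPfaffian.

Lemma map_pfs (R S : comNzRingType) (f : {rmorphism R -> S}) n (A : 'M[R]_n) I :
  f (pfs A I) = pfs (map_mx f A) I.
Proof.
rewrite /pfs rmorph_sum; apply: eq_bigr => s _.
rewrite /matching_weight rmorphM rmorph_sign rmorph_prod; congr (_ * _).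
by apply: eq_bigr => i _; rewrite mxE.
Qed.

(** Both sides satisfy the same expansion, which only depends on the order of the
    indices. *)
Lemma pfs_mxsub (R : comNzRingType) n N (f : 'I_N -> 'I_n) (A : 'M[R]_n) J :
  {mono f : i j / (i < j)%N} -> alternating_mx A ->
  pfs (mxsub f f A) J = pfs A (f @: J).
Proof.
move=> fm altA.
have fI : injective f.
  move=> i j e; have := fm i j; have := fm j i; rewrite e ltnn.
  by case: ltngtP => // /val_inj.
have altA' : alternating_mx (mxsub f f A).
  by split=> [i|i j]; rewrite !mxE ?altA.1 // altA.2.
have rankf (K : {set 'I_N}) k : rank_in (f @: K) (f k) = rank_in K k.
  rewrite /rank_in -(card_imset _ fI); apply: eq_card => x; rewrite !inE.
  apply/andP/imsetP => [[/imsetP[y yK ->]]|[y]]; first rewrite fm => lt.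
    by exists y; rewrite // inE yK.
  by rewrite inE => /andP[yK lt] ->; rewrite fm imset_f.
have fD1 (K : {set 'I_N}) k : f @: (K :\ k) = (f @: K) :\ f k.
  apply/setP => x; rewrite !inE; apply/imsetP/andP => [[y]|[xk /imsetP[y yK e]]].
    by case/setD1P=> yk yK ->; rewrite (inj_eq fI) yk imset_f.
  by exists y; rewrite // !inE yK andbT -(inj_eq fI) -e.
have [t] := ubnP #|J|; elim: t J => // t IH J ltJ.
have [->|[k kJ]] := set_0Vmem J; first by rewrite imset0 !pfs0.
rewrite (pfs_expand altA' kJ) (pfs_expand altA (imset_f f kJ)) rankf -fD1.
congr (_ * _); rewrite /contr big_imset /=; last by move=> x y _ _; exact: fI.
apply: eq_bigr => j jK; rewrite rankf !mxE -fD1 IH //.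
rewrite (cardsD1 k) kJ in ltJ; rewrite (cardsD1 j) jK in ltJ.
by move: ltJ; rewrite /= !add1n ltnS => /ltnW.
Qed.

(** * First-order perturbation of the Pfaffian by a decomposable form *)

Section Perturbation.
Variables (R : idomainType) (n : nat).
Variables (B : 'M[R]_n) (Y w : 'I_n -> R) (c : R) (al : 'I_n -> 'I_n -> R).
Hypotheses (altB : alternating_mx B) (c0 : c != 0).
Hypothesis alE : forall i j, c * al i j = Y i * w j - Y j * w i.
Implicit Types (I : {set 'I_n}) (i j l : 'I_n).

(** The derivative of [pfs C I] in the direction [al']. *)
Definition pfs_deriv (R' : comNzRingType) (C : 'M[R']_n) (al' : 'I_n -> 'I_n -> R') I : R' :=
  \sum_(i in I) \sum_(j in I | (i < j)%N) rem_sign R' I i j * al' i j * pfs C (I :\ i :\ j).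

(** In a decomposable direction the derivative is a double contraction, for the
    pairs [i < j] and [j < i] combine into Y_i w_j - Y_j w_i. *)
Lemma pfs_derivE I :
  c * pfs_deriv B al I = contr Y (contr w (pfs B)) I.
Proof.
rewrite contr2E.
have -> : \sum_(i in I) \sum_(j in I :\ i)
    rem_sign R I i j * (Y i * w j) * pfs B (I :\ i :\ j) =
   \sum_(i in I) \sum_(j in I | (i < j)%N) rem_sign R I i j * (Y i * w j) * pfs B (I :\ i :\ j)
   + \sum_(i in I) \sum_(j in I | (j < i)%N) rem_sign R I i j * (Y i * w j) * pfs B (I :\ i :\ j).
  rewrite -big_split; apply: eq_bigr => i iI /=.
  rewrite (bigID (fun j : 'I_n => (i < j)%N)) /=; congr (_ + _); apply: eq_bigl => j;
    rewrite !inE -val_eqE; case: (j \in I); rewrite ?andbF //= ?andbT; by case: ltngtP.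
rewrite [X in _ = _ + X](exchange_big_dep (fun j => j \in I)) //=; last by move=> i j _ /andP[].
rewrite -big_split mulr_sumr; apply: eq_bigr => i iI /=.
rewrite [X in _ = _ + X](eq_bigl (fun j => (j \in I) && (i < j)%N)); last first.
  by move=> j; rewrite iI /=.
rewrite -big_split mulr_sumr; apply: eq_bigr => j /andP[jI lt] /=.
have ij : i != j by rewrite -val_eqE ltn_eqF.
rewrite (rem_signC R jI iI) 1?eq_sym // (setD1C I j i).
have := alE i j => E; ring: E.
Qed.

Lemma sum_below_max (F : {set 'I_n} -> R) (a : 'I_n -> R) I l :
  l \in I -> {in I, forall i : 'I_n, (i <= l)%N} ->
  \sum_(i in I :\ l) (-1) ^+ rank_in I i * (a i * F (I :\ i :\ l)) = contr a F (I :\ l).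
Proof.
move=> lI lmax; apply: eq_bigr => i /setD1P[il iI]; rewrite (rank_inD1 i lI).
by rewrite ltnNge lmax // add0n setD1C mulrA.
Qed.

Lemma rank_in_max I l t : (0 < t)%N -> #|I| = t.*2 -> l \in I ->
  {in I, forall i : 'I_n, (i <= l)%N} -> (-1) ^+ rank_in I l = -1 :> R.
Proof.
move=> t0 cI lI lmax; have -> : rank_in I l = (t.*2).-1.
  rewrite -cI (cardsD1 l) lI /rank_in; apply: eq_card => i; rewrite !inE.
  case iI: (i \in I); rewrite ?andbF ?andbT //=.
  by have := lmax i iI; rewrite leq_eqVlt -val_eqE; case: ltngtP.
by case: t t0 {cI} => // t _; rewrite doubleS /= -signr_odd /= odd_double expr1.
Qed.

(** The polynomial Z pf + (derivative), with Z standing for f_n, is reproduced by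
    expansion along the last row of Z B + al, except for a factor Z: the lemmas
    below compare the coefficients of Z^2, Z and 1. *)
Section Recursion.
Variables (I : {set 'I_n}) (l : 'I_n) (t : nat).
Hypotheses (t0 : (0 < t)%N) (cI : #|I| = t.*2) (lI : l \in I).
Hypothesis lmax : {in I, forall i : 'I_n, (i <= l)%N}.

Let Bl : contr (B^~ l) ^~ (I :\ l) =1 (fun F => - contr (B l) F (I :\ l)).
Proof.
move=> F; rewrite /contr -sumrN; apply: eq_bigr => i _; rewrite altB.2; ring.
Qed.

Let insl (F : {set 'I_n} -> R) : ins l F (I :\ l) = - F I.
Proof.
rewrite /ins setD11 setD1K //.
have := rank_inD1 l lI; rewrite ltnn add0n => <-.
by rewrite (rank_in_max t0 cI lI lmax) mulN1r.
Qed.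

Lemma pfs_recursion2 :
  \sum_(i in I :\ l) (-1) ^+ rank_in I i * (B i l * pfs B (I :\ i :\ l)) = pfs B I.
Proof.
by rewrite (sum_below_max _ (B^~ l)) // Bl contr_pfs // insl opprK.
Qed.

Let al_contr F : c * contr (al^~ l) F (I :\ l) =
  w l * contr Y F (I :\ l) - Y l * contr w F (I :\ l).
Proof.
rewrite -!contr_combZ -contr_combB; apply: eq_contr_coef => i _.
by rewrite alE; ring.
Qed.

Lemma pfs_recursion1 :
  \sum_(i in I :\ l) (-1) ^+ rank_in I i *
     (al i l * pfs B (I :\ i :\ l) + B i l * pfs_deriv B al (I :\ i :\ l)) =
  pfs_deriv B al I.
Proof.
apply: (mulfI c0); rewrite pfs_derivE.
under eq_bigr => i _ do rewrite mulrDr.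
rewrite big_split mulrDr /= (sum_below_max _ (al^~ l)) // (sum_below_max _ (B^~ l)) //.
rewrite al_contr Bl mulrN -(contrZ (B l) c).
rewrite (@eq_contr _ _ (B l) _ (contr Y (contr w (pfs B)))) => [|i _]; last exact: pfs_derivE.
(* move the contraction by row l inwards, where it acts as an insertion, and
   then move the insertion outwards *)
have e1 : contr (B l) (contr Y (contr w (pfs B))) (I :\ l) =
          contr Y (contr w (ins l (pfs B))) (I :\ l).
  rewrite contr_anticomm -contrN; apply: eq_bigr => i _; congr (_ * _).
  rewrite contr_anticomm opprK; apply: eq_bigr => j _; congr (_ * _).
  exact: contr_pfs.
have e2 : contr Y (contr w (ins l (pfs B))) (I :\ l) =
    w l * contr Y (pfs B) (I :\ l) - contr Y (ins l (contr w (pfs B))) (I :\ l).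
  rewrite -contrZ -contrN -contrD; apply: eq_bigr => i _; congr (_ * _).
  by rewrite -(ins_contr l w) ; ring.
have e3 := ins_contr l Y (contr w (pfs B)) (I :\ l).
rewrite insl in e3.
have e4 : contr Y (ins l (contr w (pfs B))) (I :\ l) =
    Y l * contr w (pfs B) (I :\ l) + contr Y (contr w (pfs B)) I by rewrite -e3; ring.
by rewrite e1 e2 e4; ring.
Qed.

(** The derivative is already contracted by [Y] and [w], and contracting by
    either of them again gives zero. *)
Lemma pfs_recursion0 :
  \sum_(i in I :\ l) (-1) ^+ rank_in I i * (al i l * pfs_deriv B al (I :\ i :\ l)) = 0.
Proof.
apply: (mulfI c0); apply: (mulfI c0); rewrite (sum_below_max _ (al^~ l)) // al_contr !mulr0.
rewrite mulrBr !(mulrCA c) -!(contrZ _ c).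
rewrite !(@eq_contr _ _ _ _ (contr Y (contr w (pfs B)))); try by move=> i _; exact: pfs_derivE.
rewrite contr_nilp contr_anticomm contr0 ?oppr0 ?mulr0 ?subr0 // => J.
exact: contr_nilp.
Qed.

End Recursion.

End Perturbation.

(** * Minors of the bordered matrix *)

Lemma sum_lift_max (V : nmodType) m (F : 'I_m.+1 -> V) :
  \sum_c F c = \sum_h F (lift ord_max h) + F ord_max.
Proof.
rewrite big_ord_recr /=; congr (_ + _); apply: eq_bigr => h _; congr F.
by apply: val_inj; rewrite /= /bump leqNgt ltn_ord.
Qed.

Lemma sum_mulrCA (R : comNzRingType) (T : finType) (c : R) (F G : T -> R) :
  \sum_t F t * (c * G t) = c * \sum_t F t * G t.
Proof. by rewrite mulr_sumr; apply: eq_bigr => t _; rewrite mulrCA. Qed.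

Section BorderedMinors.
Variables (R : comNzRingType) (m : nat) (X : 'M[R]_(m.+1, m)).
Hypothesis m_odd : odd m.
Implicit Types (i j r l : 'I_m.+1) (h : 'I_m).

Definition border (z : 'I_m.+1 -> R) : 'M[R]_m.+1 :=
  \matrix_(r, c) if unlift ord_max c is Some h then X r h else z r.

Lemma col'_border z : col' ord_max (border z) = X.
Proof. by apply/matrixP => r h; rewrite !mxE liftK. Qed.

Lemma cofactor_border z i : cofactor (border z) i ord_max = - signed_minor X i.
Proof.
rewrite /cofactor col'_border exprD -(signr_odd _ m) m_odd expr1.
by rewrite mulrN1 mulNr.
Qed.

Lemma det_border z : \det (border z) = - \sum_i signed_minor X i * z i.
Proof.
rewrite (expand_det_col _ ord_max) -sumrN; apply: eq_bigr => i _.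
by rewrite cofactor_border !mxE unlift_none mulrN mulrC.
Qed.

(** The minors [minor2] with their signs (see [bordered_minorE]), as cofactors
    of [X] bordered by a unit column: this is where Cramer's rule applies. *)
Definition bordered_minor h i j : R :=
  cofactor (border (unit_fun R j)) i (lift ord_max h).

Lemma sum_unit (F : 'I_m.+1 -> R) j : \sum_i F i * unit_fun R j i = F j.
Proof.
rewrite (bigD1 j) //= big1 ?addr0 => [|i /negPf ij].
  by rewrite /unit_fun eqxx mulr1.
by rewrite /unit_fun ij mulr0.
Qed.

(** Cramer's rule for [X] bordered by the column [e_j], whose determinant is
    -Y_j. *)
Lemma bordered_minor_lift r i j :
  \sum_h X r h * bordered_minor h i j =
  signed_minor X i * (r == j)%:R - signed_minor X j * (r == i)%:R.
Proof.
have /matrixP/(_ r i) := mul_mx_adj (border (unit_fun R j)).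
rewrite !mxE sum_lift_max !mxE unlift_none cofactor_border det_border sum_unit.
under eq_bigr => h _ do rewrite !mxE liftK.
rewrite -/(bordered_minor _ _ _) => e.
have {e}-> : \sum_h X r h * bordered_minor h i j =
  (- signed_minor X j) *+ (r == i) - unit_fun R j r * - signed_minor X i.
  by rewrite -e /bordered_minor; ring.
rewrite /unit_fun -mulr_natr; ring.
Qed.

(** Bordering [X] by its own column [h] gives determinant zero. *)
Lemma signed_minor_mul h : \sum_i signed_minor X i * X i h = 0.
Proof.
apply: oppr_inj; rewrite -(det_border (X^~ h)) oppr0 -det_tr.
apply: (@determinant_alternate _ _ _ (lift ord_max h) ord_max) => [|r].
  by rewrite eq_sym neq_lift.
by rewrite !mxE liftK unlift_none.
Qed.

(** The adjugate of [X] without row [l]; it makes [X] injective also modulo any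
    element prime to Y_l. *)
Lemma signed_minor_left_inverse l : exists L : 'M[R]_(m, m.+1),
  L *m X = (signed_minor X l)%:M.
Proof.
exists (((-1) ^+ l *: \adj (row' l X)) *m rowsub (lift l) 1%:M).
rewrite -mulmxA mul_rowsub_mx mul1mx.
have -> : rowsub (lift l) X = row' l X by apply/matrixP => i j; rewrite !mxE.
by rewrite -scalemxAl mul_adj_mx scale_scalar_mx.
Qed.

End BorderedMinors.

Lemma bordered_minorE (R : comNzRingType) m (X : 'M[R]_(m.+1, m)) h (i j : 'I_m.+1) :
  odd m -> (i < j)%N ->
  bordered_minor X h i j = (-1) ^+ (i + j + h).+1 * minor2 X h i j.
Proof.
move=> m_odd lt; have ij : i != j by rewrite -val_eqE ltn_eqF.
rewrite /bordered_minor /cofactor /minor2.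
case: (unliftP j i) => [i' ei|e]; last by rewrite e eqxx in ij.
case: (unliftP i j) => [j' ej|e]; last by rewrite e eqxx in ij.
have i'E : i' = i :> nat by move: lt (congr1 val ei); rewrite /= /bump; lia.
have j'E : (j'.+1 = j :> nat) by move: lt (congr1 val ej); rewrite /= /bump; lia.
case: m X m_odd i j lt ij h i' j' i'E j'E ei ej => // n X n_odd i j lt ij h i' j' i'E j'E ei ej.
have maxE : lift (lift ord_max h) (ord_max : 'I_n.+1) = ord_max :> 'I_n.+2.
  by apply: val_inj; rewrite /= /bump; have := ltn_ord h; lia.
set M := row' i _.
rewrite (expand_det_col M ord_max) (bigD1 j') //= big1 ?addr0 => [|x xj]; last first.
  rewrite !mxE maxE unlift_none /unit_fun ej (inj_eq (@lift_inj _ _)) (negPf xj) mul0r //.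
rewrite {1}/M !mxE maxE unlift_none /unit_fun -ej eqxx mul1r /cofactor mulrA -exprD.
congr (_ * _).
  rewrite -signr_odd -[RHS]signr_odd; congr (_ ^+ nat_of_bool _).
  rewrite /= /bump leqNgt ltn_ord -j'E !oddD /=. move: n_odd; rewrite /= => /negPf ->.
  by do 3!case: odd.
congr (\det _); apply/matrixP => x y; rewrite !mxE.
have -> : lift i (lift j' x) = lift j (lift i' x).
  apply: val_inj; rewrite /= i'E; move: lt; rewrite -j'E.
  move: (i : nat) (j' : nat) (x : nat) => a b c; rewrite /bump; lia.
have -> : lift (lift ord_max h) (lift ord_max y) = lift ord_max (lift h y).
  apply: val_inj; rewrite /= /bump; have := ltn_ord h; have := ltn_ord y => /=; lia.
by rewrite liftK.
Qed.

(** Over a domain the remaining identities between minors need no determinant: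
    [X] is injective, and both sides have the same image by
    [bordered_minor_lift]. *)
Section BorderedMinorsDomain.
Variables (R : idomainType) (m : nat) (X : 'M[R]_(m.+1, m)) (p : 'I_m.+1).
Hypotheses (m_odd : odd m) (Yp : signed_minor X p != 0).
Implicit Types (i j r l : 'I_m.+1) (h : 'I_m).
Local Notation Y := (signed_minor X).
Local Notation A := (bordered_minor X).

Lemma X_injective (z z' : 'I_m -> R) :
  (forall r, \sum_h X r h * z h = \sum_h X r h * z' h) -> z =1 z'.
Proof.
move=> e; have [L LX] := signed_minor_left_inverse X p.
have colE (y : 'I_m -> R) : Y p *: (\col_h y h) = L *m (\col_r \sum_h X r h * y h).
  rewrite -mul_scalar_mx -LX -mulmxA; congr (_ *m _).
  by apply/matrixP => r c; rewrite !mxE; apply: eq_bigr => h _; rewrite !mxE.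
have /matrixP E : Y p *: (\col_h z h) = Y p *: (\col_h z' h).
  by rewrite !colE; congr (_ *m _); apply/matrixP => r c; rewrite !mxE e.
by move=> h; have := E h 0; rewrite !mxE => /(mulfI Yp).
Qed.

Lemma bordered_minorC h i j : A h j i = - A h i j.
Proof.
move: h; apply: X_injective => r.
under [RHS]eq_bigr => h _ do rewrite mulrN.
by rewrite sumrN !bordered_minor_lift // opprB.
Qed.

(** All [A h] share the factor [Y]. *)
Lemma bordered_minor_plucker h i j :
  Y p * A h i j = Y i * A h p j - Y j * A h p i.
Proof.
move: h; apply: X_injective => r.
under [RHS]eq_bigr => h _ do rewrite mulrBr.
by rewrite sumrB !sum_mulrCA !bordered_minor_lift //; ring.
Qed.

Lemma bordered_minor_mul h h' i :
  \sum_j X j h * A h' i j = Y i * (h' == h)%:R.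
Proof.
move: h'; apply: X_injective => r.
under eq_bigr => h' _ do rewrite mulr_sumr.
rewrite exchange_big /=.
under eq_bigr => j _.
  rewrite (eq_bigr (fun h' => X j h * (X r h' * A h' i j))); last by move=> h' _; ring.
  rewrite -mulr_sumr bordered_minor_lift // mulrBr.
  over.
rewrite sumrB [X in _ - X](_ : _ = 0) ?subr0; last first.
  rewrite (eq_bigr (fun j => (r == i)%:R * (Y j * X j h))); last by move=> j _; ring.
  by rewrite -mulr_sumr signed_minor_mul // mulr0.
rewrite (bigD1 r) //= eqxx big1 ?addr0 => [|j /negPf jr]; last first.
  by rewrite eq_sym jr !mulr0.
rewrite (bigD1 h) //= eqxx big1 ?addr0 => [|j /negPf jr]; last by rewrite jr !mulr0.
by rewrite !mulr1 mulrC.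
Qed.

(** Hilbert-Burch: solving by Cramer's rule over two denominators without
    common factor. *)
Lemma hilbert_burch q (y : 'I_m.+1 -> R) :
  Y q != 0 -> (forall a b, Y p * a = Y q * b -> exists c, a = Y q * c) ->
  \sum_i Y i * y i = 0 -> exists z : 'I_m -> R, forall r, y r = \sum_h X r h * z h.
Proof.
move=> Yq reg Yy.
have sol l r : \sum_h X r h * (\sum_j A h l j * y j) = Y l * y r.
  under eq_bigr => h _ do rewrite mulr_sumr.
  rewrite exchange_big /=.
  under eq_bigr => j _.
    rewrite (eq_bigr (fun h => y j * (X r h * A h l j))); last by move=> h _; ring.
    rewrite -mulr_sumr bordered_minor_lift // mulrBr.
    over.
  rewrite sumrB [X in _ - X](_ : _ = 0) ?subr0; last first.
    rewrite (eq_bigr (fun j => (r == l)%:R * (Y j * y j))); last by move=> j _; ring.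
    by rewrite -mulr_sumr Yy mulr0.
  rewrite (bigD1 r) //= eqxx big1 ?addr0 => [|j /negPf jr]; last first.
    by rewrite eq_sym jr !mulr0.
  by rewrite !mulr1 mulrC.
have E h : Y p * (\sum_j A h q j * y j) = Y q * (\sum_j A h p j * y j).
  move: h; apply: X_injective => r.
  by rewrite !sum_mulrCA !sol mulrCA.
have Ez h : exists c, \sum_j A h q j * y j == Y q * c.
  by have [c ->] := reg _ _ (E h); exists c.
pose z h := xchoose (Ez h).
have zE h : \sum_j A h q j * y j = Y q * z h by apply/eqP; exact: (xchooseP (Ez h)).
exists z => r; apply: (mulfI Yq); rewrite -sol mulr_sumr.
by apply: eq_bigr => h _; rewrite zE mulrCA.
Qed.

End BorderedMinorsDomain.

(** * The Pfaffian adjoint *)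

Section PfaffianAdjoint.
Variables (R : comNzRingType) (n : nat) (B : 'M[R]_n).
Hypothesis altB : alternating_mx B.
Implicit Types (a b c y z w : 'I_n -> R) (i j k l r : 'I_n).
Local Notation pf := (pfs B).
Local Notation e_ := (@unit_fun R n).

(** The alternating form whose matrix is the Pfaffian adjoint of [B]. *)
Definition pf_form a b : R := contr a (contr b pf) setT.

Lemma pf_formC a b : pf_form a b = - pf_form b a.
Proof. exact: contr_anticomm. Qed.

Lemma pf_form_row a k : pf_form a (B k) = a k * pf setT.
Proof.
have -> : pf_form a (B k) = contr a (ins k pf) setT.
  by apply: eq_bigr => i _; rewrite contr_pfs.
by rewrite -(ins_contr k a) /ins inE add0r.
Qed.

Lemma pf_form_suml (T : finType) (c : T -> R) (a : T -> 'I_n -> R) b :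
  pf_form (fun i => \sum_t c t * a t i) b = \sum_t c t * pf_form (a t) b.
Proof. exact: contr_lin. Qed.

Lemma pf_form_sumr (T : finType) (c : T -> R) a (b : T -> 'I_n -> R) :
  pf_form a (fun i => \sum_t c t * b t i) = \sum_t c t * pf_form a (b t).
Proof.
rewrite pf_formC pf_form_suml -sumrN; apply: eq_bigr => t _.
by rewrite [in RHS]pf_formC mulrN.
Qed.

Lemma eq_pf_form a a' b b' : a =1 a' -> b =1 b' -> pf_form a b = pf_form a' b'.
Proof.
move=> ea eb; rewrite /pf_form (@eq_contr_coef _ _ a a'); last by move=> i _.
by apply: eq_bigr => i _; rewrite (@eq_contr_coef _ _ b b').
Qed.

Lemma sum_unit_funE a : (fun i => \sum_j a j * e_ j i) =1 a.
Proof.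
move=> i; rewrite (bigD1 i) //= big1 ?addr0 => [|j /negPf ij].
  by rewrite /unit_fun eqxx mulr1.
by rewrite /unit_fun eq_sym ij mulr0.
Qed.

Lemma mul_pf_adjoint y k : \sum_r B k r * pf_form y (e_ r) = y k * pf setT.
Proof.
rewrite -pf_form_sumr -pf_form_row; apply: eq_pf_form => // i.
exact: (sum_unit_funE (B k)).
Qed.

Lemma pf_adjoint_mul z r : pf_form (fun i => \sum_k B i k * z k) (e_ r) = z r * pf setT.
Proof.
have -> : pf_form (fun i => \sum_k B i k * z k) (e_ r) =
          pf_form (fun i => \sum_k (- z k) * B k i) (e_ r).
  apply: eq_pf_form => // i; apply: eq_bigr => k _; rewrite altB.2; ring.
rewrite pf_form_suml; under eq_bigr => k _ do rewrite pf_formC pf_form_row mulrNN mulrA.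
rewrite -mulr_suml; congr (_ * _).
rewrite (bigD1 r) //= big1 ?addr0 => [|j /negPf ij].
  by rewrite /unit_fun eqxx mulr1.
by rewrite /unit_fun ij mulr0.
Qed.

(** Contraction by a row of [B] is an insertion, which is moved outwards through
    the three other contractions. *)
Lemma pf_form4_row a b c l :
  contr a (contr b (contr c (contr (B l) pf))) setT =
  c l * pf_form a b - b l * pf_form a c + a l * pf_form b c.
Proof.
have e1 : contr a (contr b (contr c (contr (B l) pf))) setT =
          contr a (contr b (contr c (ins l pf))) setT.
  apply: eq_bigr => i _; congr (_ * _); apply: eq_bigr => j _; congr (_ * _).
  by apply: eq_bigr => k _; rewrite contr_pfs.
have ic d F I : contr d (ins l F) I = d l * F I - ins l (contr d F) I.
  by rewrite -(ins_contr l d); ring.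
have e2 : contr a (contr b (contr c (ins l pf))) setT =
    c l * pf_form a b - contr a (contr b (ins l (contr c pf))) setT.
  rewrite /pf_form -contrZ -contrN -contrD; apply: eq_bigr => i _; congr (_ * _).
  rewrite -contrZ -contrN -contrD; apply: eq_bigr => j _; congr (_ * _).
  exact: ic.
have e3 : contr a (contr b (ins l (contr c pf))) setT =
    b l * pf_form a c - contr a (ins l (contr b (contr c pf))) setT.
  rewrite /pf_form -contrZ -contrN -contrD; apply: eq_bigr => i _; congr (_ * _).
  exact: ic.
have e4 : contr a (ins l (contr b (contr c pf))) setT = a l * pf_form b c.
  by rewrite ic /ins inE subr0.
by rewrite e1 e2 e3 e4; ring.
Qed.

Lemma contr_rot4 a b c d F I : contr a (contr b (contr c (contr d F))) I =
  - contr d (contr a (contr b (contr c F))) I.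
Proof.
rewrite [in RHS]contr_anticomm opprK.
apply: eq_bigr => i _; congr (_ * _).
rewrite [in RHS]contr_anticomm -contrN; apply: eq_bigr => j _; congr (_ * _).
exact: contr_anticomm.
Qed.

(** Modulo the Pfaffian, [B] bordered by [Y] has corank one: a vector killed by
    [B] and orthogonal to [Y] vanishes up to [pf_form Y (e_ p)] as soon as its
    entry of index [p] does. The witness is a combination of Pfaffians of
    [B] with four rows removed, evaluated by [pf_form4_row]. *)
Lemma corank_one Y p w b : (forall k, \sum_i B k i * w i = pf setT * b k) ->
  \sum_i Y i * w i = 0 -> w p = 0 ->
  forall k, exists d, pf_form Y (e_ p) * w k = pf setT * d.
Proof.
move=> Bw Yw wp k.
pose F := contr (e_ p) (contr Y (contr (e_ k) pf)).
have Fb : contr (fun i => \sum_l w l * B l i) F setT = - (pf setT * contr b F setT).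
  rewrite -contr_combZ /contr -sumrN; apply: eq_bigr => i _.
  rewrite -Bw -mulNr -mulrN; congr (_ * _ * _).
  by rewrite -sumrN; apply: eq_bigr => l _; rewrite altB.2; ring.
exists (- contr b F setT); rewrite mulrN -Fb contr_lin.
have -> : \sum_l w l * contr (B l) F setT =
   \sum_l (pf_form (e_ p) (e_ k) * (Y l * w l)
            - pf_form (e_ p) Y * (w l * e_ k l) - pf_form Y (e_ k) * (w l * e_ p l)).
  apply: eq_bigr => l _; rewrite /F; have := contr_rot4 (e_ p) Y (e_ k) (B l) pf setT.
  rewrite pf_form4_row // /unit_fun ![l == _]eq_sym => /(congr1 -%R); rewrite opprK => <-.
  by ring.
rewrite !sumrB -!mulr_sumr Yw.
have sw q : \sum_l w l * e_ q l = w q.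
  rewrite (bigD1 q) //= big1 ?addr0 => [|j /negPf ij].
    by rewrite /unit_fun eqxx mulr1.
  by rewrite /unit_fun ij mulr0.
by rewrite !sw wp [pf_form (e_ p) Y]pf_formC; ring.
Qed.

End PfaffianAdjoint.

(** * The differentials and their exactness *)

Lemma rank_in_setT n (r : 'I_n) : rank_in setT r = r.
Proof.
rewrite /rank_in -sum1_card (eq_bigl (fun i : 'I_n => (i < r)%N)) => [|i]; last by rewrite !inE.
by rewrite -(big_ord_widen n (fun=> 1%N) (ltnW (ltn_ord r))) sum1_card card_ord.
Qed.

Lemma rank_in_setC1 n (i j : 'I_n) : j != i -> (rank_in (~: [set i]) j + (i < j) = j)%N.
Proof.
by move=> ji; rewrite -[RHS]rank_in_setT (rank_inD1 j (in_setT i)) addnC setTD.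
Qed.

Lemma setC1D1 n (i j : 'I_n) : ~: [set i] :\ j = ~: [set i; j].
Proof. by rewrite setDE -setCU. Qed.

Section TopDifferentials.
Variables (R : idomainType) (m : nat) (X : 'M[R]_(m.+1, m)) (B : 'M[R]_m.+1).
Hypotheses (m_odd : odd m) (altB : alternating_mx B).
Implicit Types (i j k r l p q : 'I_m.+1) (h : 'I_m).
Local Notation Y := (signed_minor X).
Local Notation A := (bordered_minor X).
Local Notation pf := (pfs B).
Local Notation e_ := (@unit_fun R m.+1).

(** The entries of the first differential; [top_v setT] gives all but the last
    one of the third. *)
Definition top_u r : R := pf_form B Y (e_ r).
Definition top_v (I : {set 'I_m.+1}) h : R := pfs_deriv B (A h) I.

Lemma top_uE r : top_u r = (-1) ^+ r.+1 * contr Y pf (~: [set r]).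
Proof.
rewrite /top_u pf_formC /pf_form contr_unit inE -setTD rank_in_setT exprS mulN1r.
by rewrite mulNr.
Qed.

Lemma sum_Y_u : \sum_i Y i * top_u i = 0.
Proof.
rewrite /top_u -pf_form_sumr (@eq_pf_form _ _ _ _ Y _ Y) //; last exact: sum_unit_funE.
exact: contr_nilp.
Qed.

Lemma sum_B_u k : \sum_i B k i * top_u i = Y k * pf setT.
Proof. exact: mul_pf_adjoint. Qed.

(** By [bordered_minor_lift], [X] turns the directions [A h] into Y /\ e_r. *)
Lemma sum_X_v r : \sum_h X r h * top_v setT h = top_u r.
Proof.
have -> : \sum_h X r h * top_v setT h =
    pfs_deriv B (fun i j => Y i * e_ r j - Y j * e_ r i) setT.
  rewrite /top_v /pfs_deriv; under eq_bigr => h _ do rewrite mulr_sumr.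
  rewrite exchange_big; apply: eq_bigr => i _ /=.
  under eq_bigr => h _ do rewrite mulr_sumr.
  rewrite exchange_big; apply: eq_bigr => j _ /=.
  rewrite /unit_fun ![_ == r]eq_sym -bordered_minor_lift // mulr_sumr mulr_suml.
  by apply: eq_bigr => h _; ring.
rewrite -[LHS]mul1r (@pfs_derivE _ _ B Y (e_ r)) // => i j; exact: mul1r.
Qed.

Section Exactness.
Variables p q a b : 'I_m.+1.
Hypotheses (pf0 : pf setT != 0) (Yp : Y p != 0) (Yq : Y q != 0).
Hypothesis reg_Y : forall x y, Y p * x = Y q * y -> exists z, x = Y q * z.
Hypothesis reg_Y_pf : forall x y, Y p * x = pf setT * y -> exists z, x = pf setT * z.
Hypothesis reg_u_pf : forall x y, top_u a * x = pf setT * y -> exists z, x = pf setT * z.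
Hypothesis reg_uu_pf : forall x y y', top_u b * x = top_u a * y + pf setT * y' ->
  exists z z', x = top_u a * z + pf setT * z'.

Lemma top_exact2 (z : 'I_m -> R) (z0 : R) :
  (forall i, - (\sum_h (\sum_j X j h * B i j) * z h) + Y i * z0 = 0) ->
  exists c, (forall h, z h = top_v setT h * c) /\ z0 = pf setT * c.
Proof.
move=> Hz.
have BXz i : \sum_j B i j * (\sum_h X j h * z h) = Y i * z0.
  have := Hz i; rewrite addrC => /subr0_eq ->.
  under eq_bigr => j _ do rewrite mulr_sumr.
  rewrite exchange_big; apply: eq_bigr => h _ /=; rewrite mulr_suml.
  by apply: eq_bigr => j _; ring.
have Xz r : pf setT * (\sum_h X r h * z h) = top_u r * z0.
  have := pf_adjoint_mul altB (fun j => \sum_h X j h * z h) r.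
  rewrite mulrC => <-; rewrite /top_u mulrC -(contr_combZ z0).
  by apply: eq_pf_form => // i; rewrite BXz mulrC.
have zv : (fun h => pf setT * z h) =1 (fun h => z0 * top_v setT h).
  apply: (X_injective Yp) => r.
  by rewrite !sum_mulrCA sum_X_v Xz mulrC.
have [c z0c] := reg_u_pf (esym (Xz a)).
exists c; split=> // h; apply: (mulfI pf0); rewrite zv z0c; ring.
Qed.

Lemma top_exact1 (y : 'I_m.+1 -> R) : \sum_i top_u i * y i = 0 ->
  exists (z : 'I_m -> R) (z0 : R), forall i,
    y i = - (\sum_h (\sum_j X j h * B i j) * z h) + Y i * z0.
Proof.
move=> uy.
pose Py r := pf_form B y (e_ r).
have YPy : \sum_r Y r * Py r = 0.
  rewrite /Py -pf_form_sumr pf_formC; apply/eqP; rewrite oppr_eq0; apply/eqP.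
  rewrite -[RHS]uy; under [RHS]eq_bigr => r _ do rewrite mulrC.
  rewrite /top_u -pf_form_sumr; apply: eq_pf_form => i.
    exact: (sum_unit_funE Y).
  exact/esym/(sum_unit_funE y).
have [z PyX] := hilbert_burch m_odd Yp Yq reg_Y YPy.
(* Modulo the Pfaffian, both Py and u are killed by B and orthogonal to Y; the
   combination below also has its entry of index a equal to zero. *)
have prop k : exists d, top_u a * (top_u a * Py k - Py a * top_u k) = pf setT * d.
  apply: (@corank_one _ _ B altB Y a (fun i => top_u a * Py i - Py a * top_u i)
    (fun k => top_u a * y k - Py a * Y k)).
  - move=> j; under eq_bigr => i _ do rewrite mulrBr.
    by rewrite sumrB !sum_mulrCA sum_B_u mul_pf_adjoint //; ring.
  - under eq_bigr => i _ do rewrite mulrBr.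
    by rewrite sumrB !sum_mulrCA sum_Y_u YPy; ring.
  - by ring.
have prop1 k : exists d, top_u a * Py k - Py a * top_u k = pf setT * d.
  by have [d e] := prop k; have [d' e'] := reg_u_pf e; exists d'.
have [c [c' Pac]] : exists c c', Py a = top_u a * c + pf setT * c'.
  have [d e] := prop1 b; apply: (@reg_uu_pf _ (Py b) (- d)).
  by rewrite mulrN -e; ring.
have Puc k : exists d, Py k - top_u k * c = pf setT * d.
  have [d e] := prop1 k; apply: (@reg_u_pf _ (d + c' * top_u k)).
  by rewrite [pf _ * _]mulrDr -e Pac; ring.
(* Py = u c modulo Pf now gives z = v c modulo Pf, as u = X v. *)
have zvc h : exists d, z h - top_v setT h * c = pf setT * d.
  have [L LX] := signed_minor_left_inverse X p.
  have [f Pf] := fin_all_exists Puc.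
  apply: (@reg_Y_pf _ (\sum_r L h r * f r)).
  have -> : Y p * (z h - top_v setT h * c) =
      ((Y p)%:M *m (\col_h (z h - top_v setT h * c))) h 0.
    by rewrite mul_scalar_mx !mxE.
  rewrite -LX -mulmxA !mxE -sum_mulrCA; apply: eq_bigr => r _; congr (_ * _).
  rewrite !mxE -Pf PyX -sum_X_v mulr_suml -sumrB; apply: eq_bigr => h' _.
  by rewrite !mxE; ring.
have [z2 z2E] := fin_all_exists zvc.
exists (fun h => - z2 h), c => i; apply: (mulfI pf0).
rewrite mulrC -(mul_pf_adjoint altB) -/(Py _).
have Pyr r : pf_form B y (e_ r) = pf setT * (\sum_h X r h * z2 h) + top_u r * c.
  rewrite -/(Py r) PyX -sum_X_v mulr_suml mulr_sumr -big_split; apply: eq_bigr => h _ /=.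
  by rewrite mulrCA -z2E; ring.
under eq_bigr => r _ do rewrite Pyr mulrDr [_ * (_ * c)]mulrA.
rewrite big_split /= -mulr_suml sum_B_u mulrDr; congr (_ + _); last by ring.
rewrite sum_mulrCA -sumrN; congr (_ * _).
under eq_bigr => r _ do rewrite mulr_sumr.
rewrite exchange_big; apply: eq_bigr => h _ /=; rewrite mulrN opprK mulr_suml.
by apply: eq_bigr => j _; ring.
Qed.

End Exactness.

End TopDifferentials.

(** * The closed form of the construction *)

Section StandardData.
Variables (R : idomainType) (m : nat) (X : 'M[R]_(m.+1, m)) (B : 'M[R]_m.+1).
Variable p : 'I_m.+1.
Hypotheses (m_odd : odd m) (altB : alternating_mx B) (Yp : signed_minor X p != 0).
Implicit Types (i j k r l q : 'I_m.+1) (h : 'I_m) (I : {set 'I_m.+1}).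
Local Notation Y := (signed_minor X).
Local Notation A := (bordered_minor X).
Local Notation pf := (pfs B).

Definition split_col (f : 'I_m -> R) (c : R) : 'cV[R]_m.+1 :=
  \col_r if unlift ord_max r is Some h then f h else c.

Definition padX : 'M[R]_m.+1 :=
  \matrix_(j, c) if unlift ord_max c is Some h' then X j h' else 0.

(** The products e_i . e_j. *)
Definition std_ee i j : 'cV[R]_m.+1 := split_col (fun h => A h i j) (B i j).

(** The elements v_t(I), for any number of elements of [I]. *)
Definition std_v3 I : 'cV[R]_m.+1 := split_col (top_v X B I) (pf I).

(** The products e_i . f_h. *)
Definition std_ef i (h : 'I_m.+1) : R :=
  if unlift ord_max h is Some h' then - \sum_j X j h' * B i j else Y i.

Definition std_data : top_data R m :=
  TopData (fun i j => split_col (fun h => A h i j) 0) std_ef (fun=> std_v3)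
    (fun i => contr Y pf (~: [set i])).

Lemma split_colE f c r : split_col f c r 0 = if unlift ord_max r is Some h then f h else c.
Proof. by rewrite mxE. Qed.

Lemma split_col_lift f c h : split_col f c (lift ord_max h) 0 = f h.
Proof. by rewrite mxE liftK. Qed.

Lemma split_col_max f c : split_col f c ord_max 0 = c.
Proof. by rewrite mxE unlift_none. Qed.

Lemma split_col_eta (a : 'cV[R]_m.+1) :
  a = split_col (fun h => a (lift ord_max h) 0) (a ord_max 0).
Proof.
apply/matrixP => r c; rewrite ord1 split_colE; case: unliftP => [h ->|->] //.
Qed.

Lemma eq_split_col f f' c c' : f =1 f' -> c = c' -> split_col f c = split_col f' c'.
Proof. by move=> ef ->; apply/matrixP => r ?; rewrite !mxE; case: unlift. Qed.

Lemma padX_mul f c : padX *m split_col f c = \col_r \sum_h X r h * f h.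
Proof.
apply/matrixP => r ?; rewrite !mxE sum_lift_max !mxE unlift_none mul0r addr0.
by apply: eq_bigr => h _; rewrite !mxE liftK.
Qed.

Lemma alpha_std i j : padX *m split_col (fun h => A h i j) 0 =
  Y i *: base_vec R j - Y j *: base_vec R i.
Proof.
rewrite padX_mul; apply/matrixP => r c; rewrite ord1 !mxE bordered_minor_lift //.
by rewrite eqxx !andbT.
Qed.

Lemma padX_inj f f' : padX *m split_col f 0 = padX *m split_col f' 0 -> f =1 f'.
Proof.
rewrite !padX_mul => /matrixP e; apply: (X_injective Yp) => r.
by have := e r 0; rewrite !mxE.
Qed.

Lemma alpha_unique i j : unique (fun a : 'cV[R]_m.+1 => a ord_max 0 = 0 /\
    padX *m a = Y i *: base_vec R j - Y j *: base_vec R i)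
  (split_col (fun h => A h i j) 0).
Proof.
split=> [|a [a0]]; first by rewrite split_col_max alpha_std.
rewrite -alpha_std (split_col_eta a) a0 => /padX_inj e.
exact: eq_split_col.
Qed.

Lemma mul_ee_std D : (forall i j, (i < j)%N -> alpha D i j = split_col (fun h => A h i j) 0) ->
  forall i j, mul_ee B D i j = std_ee i j.
Proof.
move=> aD.
have half i j : (i < j)%N -> alpha D i j + B i j *: f_last R m = std_ee i j.
  move=> /aD ->; apply/matrixP => r c; rewrite ord1 !mxE eqxx andbT.
  case: unliftP => [h ->|->]; last by rewrite eqxx mulr1 add0r.
  by rewrite eq_sym (negPf (neq_lift _ _)) mulr0 addr0.
move=> i j; rewrite /mul_ee; case: (ltngtP i j) => [/half //|/half ->|/val_inj ->].
  apply/matrixP => r c; rewrite !mxE; case: unlift => [h|].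
    by rewrite (bordered_minorC m_odd Yp) opprK.
  by rewrite altB.2 opprK.
apply/matrixP => r c; rewrite !mxE altB.1; case: unlift => [h|//].
apply/esym; have := bordered_minor_plucker m_odd Yp h j j.
by rewrite mulrC subrr => /eqP; rewrite mulf_eq0 (negPf Yp) orbF => /eqP.
Qed.

Lemma f_last_inj c c' : c *: f_last R m = c' *: f_last R m -> c = c'.
Proof. by move/matrixP/(_ ord_max 0); rewrite !mxE !eqxx !mulr1. Qed.

(** The coordinates other than the last one vanish by [bordered_minor_mul]. *)
Lemma mul_ef_std D i (h : 'I_m.+1) : (forall j, mul_ee B D i j = std_ee i j) ->
  std_ef i h *: f_last R m =
    Y i *: base_vec R h - mul_e B D i (padX *m base_vec R h).
Proof.
move=> eeD; rewrite /mul_e /std_ef.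
have -> : padX *m base_vec R h = col h padX by rewrite colE.
case: (unliftP ord_max h) => [h' ->|->]; last first.
  rewrite big1 ?subr0 // => j _; by rewrite !mxE unlift_none scale0r.
apply/matrixP => r c; rewrite ord1 !mxE summxE eqxx !andbT.
have -> : \sum_j ((col (lift ord_max h') padX) j 0 *: mul_ee B D i j) r 0 =
   \sum_j X j h' * std_ee i j r 0.
  by apply: eq_bigr => j _; rewrite eeD !mxE liftK.
case: (unliftP ord_max r) => [h2 ->|->].
  rewrite eq_sym (negPf (neq_lift _ _)) mulr0.
  under eq_bigr => j _ do rewrite split_col_lift.
  by rewrite (bordered_minor_mul m_odd Yp) (inj_eq lift_inj) subrr.
rewrite eqxx mulr1 (negPf (neq_lift _ _)) mulr0 sub0r.
by under [in RHS]eq_bigr => j _ do rewrite split_col_max.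
Qed.

Lemma std_v3_pair i j : (i < j)%N -> std_v3 [set i; j] = std_ee i j.
Proof.
move=> lt; have ij : i != j by rewrite -val_eqE ltn_eqF.
have Di : [set i; j] :\ i = [set j] by rewrite setU1K // inE.
have Dij : [set j] :\ j = set0 by rewrite setDv.
have ri : rank_in [set i; j] i = 0%N.
  apply/eqP; rewrite cards_eq0; apply/eqP/setP => x; rewrite !inE.
  by case: eqP => [->|_]; rewrite ?ltnn //=; case: eqP => //= ->; case: ltngtP lt.
have rj : rank_in [set j] j = 0%N.
  apply/eqP; rewrite cards_eq0; apply/eqP/setP => x; rewrite !inE.
  by case: eqP => [->|]; rewrite ?ltnn.
apply: eq_split_col => [h|]; last first.
  rewrite (pfs_expand altB (setU11 _ _)) Di ri expr0 mul1r /contr big_set1.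
  by rewrite rj Dij pfs0 expr0 mul1r mulr1.
rewrite /top_v /pfs_deriv big_setU1 ?inE //= big_set1 [X in _ + X]big1 ?addr0; last first.
  by move=> x /andP[]; rewrite !inE => /orP[] /eqP ->; rewrite ?ltnn //; case: ltngtP lt.
rewrite (big_pred1 j) => [|x]; last first.
  by rewrite !inE; case: (x =P i) => [->|_]; rewrite ?ltnn ?(negPf ij) //=; case: eqP => // ->.
by rewrite /rem_sign Di ri rj Dij pfs0 expr0 mul1r mulr1.
Qed.

Section Symmetric.
Local Notation S := {mpoly R[m.+1]}.
Local Notation Z := ('X_ord_max : S).

Let al i j : S := \sum_h A h i j *: 'X_(lift ord_max h).
Let B' : 'M[S]_m.+1 := map_mx (@mpolyC _ R) B.

Lemma to_sym_split f c :
  to_sym (split_col f c) = \sum_h f h *: 'X_(lift ord_max h) + c *: Z.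
Proof.
rewrite /to_sym sum_lift_max split_col_max; congr (_ + _).
by apply: eq_bigr => h _; rewrite split_col_lift.
Qed.

Lemma to_sym_inj (w w' : 'cV[R]_m.+1) : Z * to_sym w = Z * to_sym w' -> w = w'.
Proof.
have Z0 : Z != 0.
  apply/eqP => /(congr1 (mcoeff U_(ord_max)%MM)).
  by rewrite mcoeffXU eqxx mcoeff0 => /eqP; rewrite oner_eq0.
move/(mulfI Z0)=> e; apply/matrixP => r c; rewrite ord1.
have coefE (v : 'cV[R]_m.+1) : (to_sym v)@_(U_(r)%MM) = v r 0.
  rewrite /to_sym raddf_sum /= (bigD1 r) //= mcoeffZ mcoeffXU eqxx mulr1 big1 ?addr0 // => j jr.
  by rewrite mcoeffZ mcoeffXU (negPf jr) mulr0.
by rewrite -coefE e coefE.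
Qed.

(** The coefficients of [Z ^+ 2], [Z] and [1] are the three recursions for [B]
    and the direction [al] with coefficients in the symmetric algebra. *)
Lemma std_v3_recursion t I l : (2 <= t)%N -> #|I| = t.*2 -> l \in I ->
  {in I, forall i, (i <= l)%N} ->
  Z * to_sym (std_v3 I) =
    \sum_(i in I :\ l) (-1) ^+ rank_in I i *:
       (to_sym (std_ee i l) * to_sym (std_v3 (I :\ i :\ l))).
Proof.
move=> t2 cI lI lmax; have t0 : (0 < t)%N by apply: leq_trans t2.
have altB' : alternating_mx B'.
  by split=> [i|i j]; rewrite !mxE ?altB.1 ?mpolyC0 // altB.2 mpolyCN.
pose Y' i := (Y i)%:MP : S.
have c0 : Y' p != 0 by rewrite mpolyC_eq0.
have alE i j : Y' p * al i j = Y' i * al p j - Y' j * al p i.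
  rewrite /al !mulr_sumr -sumrB; apply: eq_bigr => h _.
  rewrite !mul_mpolyC !scalerA -scalerBl; congr (_ *: _).
  exact: bordered_minor_plucker.
have pfE J : pfs B' J = (pf J)%:MP by rewrite -map_pfs.
have dE J : pfs_deriv B' al J = \sum_h top_v X B J h *: 'X_(lift ord_max h).
  rewrite /top_v /pfs_deriv; under [RHS]eq_bigr => h _ do rewrite scaler_suml.
  rewrite exchange_big; apply: eq_bigr => i _ /=.
  under [RHS]eq_bigr => h _ do rewrite scaler_suml.
  rewrite exchange_big; apply: eq_bigr => j _ /=.
  rewrite pfE /al mulr_sumr mulr_suml; apply: eq_bigr => h _.
  by move: (A h i j) (pf _) => a0 b0; rewrite /rem_sign -!mul_mpolyC !rmorphM /= rmorph_sign; ring.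
have wE J : to_sym (std_v3 J) = pfs_deriv B' al J + pfs B' J * Z.
  by rewrite to_sym_split dE pfE mul_mpolyC.
have eE i : to_sym (std_ee i l) = al i l + B' i l * Z.
  by rewrite to_sym_split mxE mul_mpolyC.
have r0 := pfs_recursion0 B' c0 alE lI lmax.
have r1 := pfs_recursion1 altB' c0 alE t0 cI lI lmax.
have r2 := pfs_recursion2 altB' t0 cI lI lmax.
rewrite wE -r2 -r1.
rewrite -[LHS]add0r -[X in X + _]r0 mulrDr mulr_suml !mulr_sumr -!big_split /=.
apply: eq_bigr => i _; rewrite eE wE -mul_mpolyC rmorph_sign; ring.
Qed.

End Symmetric.

(** The element q_i is the contraction by [Y] of v_(s-1), taken at the complement
    of [i]. Its coordinates of index [h < m] vanish, because up to the factor Y_p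
    they are contracted by [Y] twice. *)
Lemma q_lift_std D s i :
  (forall j, j != i -> v3 D s.-1 (~: [set i; j]) = std_v3 (~: [set i; j])) ->
  contr Y pf (~: [set i]) *: f_last R m = q (\row_i Y i) s D i.
Proof.
move=> vD.
have cE : q (\row_i Y i) s D i =
   \sum_(j in ~: [set i]) ((-1) ^+ rank_in (~: [set i]) j * Y j) *: std_v3 (~: [set i] :\ j).
  rewrite /q [RHS](bigID (fun j : 'I__ => (j < i)%N)) /=; congr (_ + _).
    apply: eq_big => [j|j lt]; first by rewrite !inE -val_eqE; case: ltngtP.
    have ji : j != i by rewrite -val_eqE ltn_eqF.
    rewrite vD // mxE -setC1D1; congr ((_ ^+ _ * _) *: _).
    by rewrite -[LHS](rank_in_setC1 ji) ltnNge (ltnW lt) addn0.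
  apply: eq_big => [j|j lt]; first by rewrite !inE -val_eqE -leqNgt; case: ltngtP.
  have ji : j != i by rewrite -val_eqE gtn_eqF.
  rewrite vD // mxE -setC1D1; congr ((_ * _) *: _).
  by rewrite -[in LHS](rank_in_setC1 ji) lt addn1 !exprS mulN1r mulN1r opprK.
rewrite cE; apply/matrixP => r c; rewrite ord1 summxE !mxE eqxx andbT.
case: (unliftP ord_max r) => [h ->|->]; last first.
  rewrite eqxx mulr1; apply: eq_bigr => j _.
  by rewrite mxE split_col_max.
rewrite eq_sym (negPf (neq_lift _ _)) mulr0.
have e : contr Y (fun J => top_v X B J h) (~: [set i]) = 0.
  apply: (mulfI Yp); rewrite mulr0 -contrZ.
  rewrite (@eq_contr _ _ Y _ (contr Y (contr (A h p) pf))) ?contr_nilp // => j _.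
  by apply: pfs_derivE => i' j'; exact: bordered_minor_plucker.
rewrite -[LHS]e; apply: eq_bigr => j _.
by rewrite mxE split_col_lift.
Qed.

Variable s : nat.
Hypotheses (s_ge2 : (2 <= s)%N) (nE : m.+1 = s.*2).
Local Notation is_data := (is_top_data (f_last R m) padX (\row_i Y i) B s).

Lemma pair_of_card2 I : #|I| = 2%N -> exists i j, (i < j)%N /\ I = [set i; j].
Proof.
move/eqP/cards2P=> [i [j [ij ->]]].
case: (ltngtP i j) => [lt|lt|/val_inj e]; last by rewrite e eqxx in ij.
  by exists i, j.
by exists j, i; split=> //; rewrite setUC.
Qed.

Lemma std_is_data : is_data std_data.
Proof.
have ee i j : mul_ee B std_data i j = std_ee i j by apply: mul_ee_std.
split.
- by move=> i j _; rewrite !mxE; apply: alpha_unique.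
- move=> i h; rewrite mxE; split; first by apply: mul_ef_std.
  by move=> c; rewrite -mul_ef_std // => /f_last_inj.
- by move=> i j lt; rewrite ee -std_v3_pair.
- move=> t I l t2 cI lI lmax.
  have e : 'X_ord_max * to_sym (std_v3 I) = \sum_(i in I :\ l) (-1) ^+ pos I i *:
     (to_sym (mul_ee B std_data i l) * to_sym (v3 std_data t.-1 (I :\ i :\ l))).
    rewrite (std_v3_recursion t2 cI lI lmax); apply: eq_bigr => i _.
    by rewrite ee.
  by split=> // w; rewrite -e => /to_sym_inj.
- move=> i; split; first exact: q_lift_std.
  by move=> c; rewrite -q_lift_std // => /f_last_inj.
Qed.

(** Induction on [t]: each defining equation has a unique solution, and the closed
    form is a solution. *)
Lemma is_data_std D : is_data D ->
  [/\ forall i (h : 'I_m.+1), mul_ef D i h = std_ef i h, v3 D s setT = std_v3 setT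
    & forall i, q_lift D i = contr Y pf (~: [set i])].
Proof.
case=> aP eP v1P vP qP.
have ee i j : mul_ee B D i j = std_ee i j.
  apply: mul_ee_std => i' j' /aP; rewrite !mxE => -[e _].
  by have [_ u] := alpha_unique i' j'; rewrite (u _ e).
have vE t : (0 < t)%N -> forall I, #|I| = t.*2 -> v3 D t I = std_v3 I.
  elim: t => // t IH _ I cI.
  have [t0|t0] := posnP t.
    rewrite t0 in cI *; have [i [j [lt ->]]] := pair_of_card2 cI.
    by rewrite v1P // ee std_v3_pair.
  have [l0 l0I] : exists l, l \in I by apply/set0Pn; rewrite -card_gt0 cI.
  pose l := [arg max_(i > l0 in I) (i : nat)].
  have [lI lmax] : l \in I /\ {in I, forall i : 'I_m.+1, (i <= l)%N}.
    by rewrite /l; case: arg_maxnP.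
  have [_ u] := vP t.+1 I l t0 cI lI lmax; apply: u.
  rewrite (std_v3_recursion _ cI lI lmax) //; apply: eq_bigr => i /setD1P[il iI].
  rewrite ee IH //.
  move: cI; rewrite (cardsD1 i) iI (cardsD1 l) !inE eq_sym il lI doubleS.
  by rewrite !add1n => -[].
split.
- move=> i h; have [_] := eP i h; apply.
  by rewrite mxE; apply: mul_ef_std.
- by apply: vE; rewrite ?cardsT ?card_ord // (leq_trans _ s_ge2).
move=> i; have [_] := qP i; apply; apply: q_lift_std => j ji.
apply: vE; first by rewrite -ltnS prednK // (leq_trans _ s_ge2).
have : (2 + #|~: [set i; j]|)%N = s.*2.
  by rewrite -nE -[RHS]card_ord -(cardsC [set i; j]) cards2 eq_sym ji.
by case: s s_ge2 => [|s'] // _; rewrite doubleS add2n => -[].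
Qed.

End StandardData.

(** * Regular sequences and parts of highest degree *)

Section RegularPowers.
Variable S : idomainType.
Implicit Types x g a b c : S.

(** [g] is a nonzerodivisor modulo [f], respectively modulo the ideal [(f, e)]. *)
Definition nzd_mod g f := forall a b, g * a = f * b -> exists c, a = f * c.
Definition nzd_mod2 g f e := forall a b c, g * a = f * b + e * c ->
  exists b' c', a = f * b' + e * c'.

Lemma nzd_mod_exp g x n : x != 0 -> nzd_mod g x -> nzd_mod g (x ^+ n).
Proof.
move=> x0 gx; elim: n => [|n IH] a b; first by exists a; rewrite expr0 mul1r.
rewrite exprS -mulrA => e; have [c ac] := gx _ _ e.
have [d cd] : exists d, c = x ^+ n * d.
  by apply: (IH _ b); apply: (mulfI x0); rewrite -e ac; ring.
by exists d; rewrite ac cd; ring.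
Qed.

(** Writing [a = f a2 + x a1], the relation can be divided by [x]. *)
Lemma nzd_mod2_exp g f x n : x != 0 -> nzd_mod f x -> nzd_mod2 g f x ->
  nzd_mod2 g f (x ^+ n).
Proof.
move=> x0 fx gfx; elim: n => [|n IH] a b c.
  by exists 0, a; rewrite mulr0 expr0 add0r mul1r.
rewrite exprS -mulrA => e; have [a2 [a1 aE]] := gfx _ _ _ e.
have e1 : f * (b - g * a2) = x * (g * a1 - x ^+ n * c).
  have -> : f * (b - g * a2) = (f * b + x * (x ^+ n * c)) - x * (x ^+ n * c) - f * g * a2 by ring.
  by rewrite -e aE; ring.
have [c1 c1E] := fx _ _ e1.
have e2 : g * a1 = f * c1 + x ^+ n * c.
  apply: (mulfI x0); rewrite mulrDr [x * (f * c1)]mulrCA -c1E e1; ring.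
have [d [d' dE]] := IH _ _ _ e2.
by exists (a2 + x * d), d'; rewrite aE dE; ring.
Qed.

End RegularPowers.

Section TopForms.
Variables (n : nat) (A : idomainType).
Local Notation S := {mpoly A[n]}.
Local Notation H d := (pihomog mdeg d).
Implicit Types (p q f g a b c : S).

Lemma msizeM_leq p q i j : (msize p <= i)%N -> (msize q <= j)%N ->
  (msize (p * q) <= (i + j).-1)%N.
Proof.
move=> pi qj; have [->|p0] := eqVneq p 0; first by rewrite mul0r msize0.
have [->|q0] := eqVneq q 0; first by rewrite mulr0 msize0.
rewrite msizeM //; lia.
Qed.

Lemma msizeD_leq p q i : (msize p <= i)%N -> (msize q <= i)%N -> (msize (p + q) <= i)%N.
Proof. by move=> pi qi; apply: leq_trans (msizeD_le p q) _; rewrite geq_max pi. Qed.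

Lemma msizeB_leq p q i : (msize p <= i)%N -> (msize q <= i)%N -> (msize (p - q) <= i)%N.
Proof. by move=> pi qi; apply: msizeD_leq => //; rewrite msizeN. Qed.

Lemma dhomog_msize_leq d p : p \is d.-homog -> (msize p <= d.+1)%N.
Proof.
move/dhomogP=> h; rewrite msizeE big_seq; apply: (big_ind (fun x => (x <= d.+1)%N)) => //.
  by move=> x y; rewrite geq_max => -> ->.
by move=> m /h /= ->.
Qed.

Lemma pihomog_small d p : (msize p <= d)%N -> H d p = 0.
Proof.
move=> le; rewrite pihomogE big_seq_cond big1 // => m /andP[/msize_mdeg_lt lt /eqP e].
by move: (leq_trans lt le); rewrite -e ltnn.
Qed.

Lemma msize_sub_pihomog d p : (msize p <= d.+1)%N -> (msize (p - H d p) <= d)%N.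
Proof.
move=> le; rewrite {1}(pihomog_partitionE le) big_ord_recr /= addrK.
apply: (big_ind (fun x => (msize x <= d)%N)); first by rewrite msize0.
  by move=> x y; apply: msizeD_leq.
move=> k _; apply: leq_trans (dhomog_msize_leq (pihomogP _ _ _)) _.
exact: ltn_ord.
Qed.

Lemma pihomogM e d g p : g \is e.-homog -> H (e + d) (g * p) = g * H d p.
Proof.
move=> ge; rewrite [in LHS](pihomog_partitionE (leqnn (msize p))).
rewrite [in RHS](pihomog_partitionE (leqnn (msize p))) mulr_sumr !linear_sum mulr_sumr.
apply: eq_bigr => k _ /=.
have hk : g * H k p \is (e + k).-homog by apply: dhomogM => //; exact: pihomogP.
have [<-|kd] := eqVneq (k : nat) d; first by rewrite pihomog_id pihomog_dE.
rewrite (pihomog_ne0 _ hk) ?eqn_add2l //.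
by rewrite (pihomog_ne0 kd (pihomogP _ _ _)) mulr0.
Qed.

Lemma pihomogM_small e d g p : g \is e.-homog -> (d < e)%N -> H d (g * p) = 0.
Proof.
move=> ge lt; rewrite (pihomog_partitionE (leqnn (msize p))) mulr_sumr linear_sum big1 // => k _ /=.
have hk : g * H k p \is (e + k).-homog by apply: dhomogM => //; exact: pihomogP.
by rewrite (pihomog_ne0 _ hk) // gtn_eqF // ltn_addr.
Qed.

(** [g] is the part of degree [d] of [f], and [f] has degree at most [d]; thus [g]
    may be zero. *)
Definition top_form d f g := g \is d.-homog /\ (msize (f - g) <= d)%N.

Lemma top_form_msize d f g : top_form d f g -> (msize f <= d.+1)%N.
Proof.
case=> hg hf; rewrite -[f](subrK g); apply: msizeD_leq; first exact: leqW.
exact: dhomog_msize_leq.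
Qed.

Lemma top_form_homog d g : g \is d.-homog -> top_form d g g.
Proof. by split; rewrite // subrr msize0. Qed.

Lemma top_form0 d : top_form d 0 0.
Proof. exact/top_form_homog/dhomog0. Qed.

Lemma top_form1 : top_form 0 1 1.
Proof. exact/top_form_homog/dhomog1. Qed.

Lemma top_formD d f g f' g' : top_form d f g -> top_form d f' g' ->
  top_form d (f + f') (g + g').
Proof.
case=> h1 h2 [h3 h4]; split; first exact: dhomogD.
by rewrite opprD addrACA; apply: msizeD_leq.
Qed.

Lemma top_formN d f g : top_form d f g -> top_form d (- f) (- g).
Proof.
by case=> h1 h2; split; rewrite ?dhomogN // -opprD msizeN.
Qed.

Lemma top_formM d e f g f' g' : top_form d f g -> top_form e f' g' ->
  top_form (d + e) (f * f') (g * g').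
Proof.
move=> t1 t2; have m2 := top_form_msize t2; case: t1 t2 => h1 h2 [h3 h4].
split; first exact: dhomogM.
have -> : f * f' - g * g' = (f - g) * f' + g * (f' - g') by ring.
apply: msizeD_leq.
  by apply: leq_trans (msizeM_leq h2 m2) _; rewrite addnS.
by apply: leq_trans (msizeM_leq (dhomog_msize_leq h1) h4) _; rewrite addSn.
Qed.

Lemma top_form_sum (I : Type) (r : seq I) (P : pred I) d (F G : I -> S) :
  (forall i, P i -> top_form d (F i) (G i)) ->
  top_form d (\sum_(i <- r | P i) F i) (\sum_(i <- r | P i) G i).
Proof.
move=> h; apply: (big_ind2 (fun x y => top_form d x y)) => //; first exact: top_form0.
by move=> *; apply: top_formD.
Qed.

Lemma top_form_prod (I : finType) (P : pred I) (F G : I -> S) :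
  (forall i, P i -> top_form 1 (F i) (G i)) ->
  top_form #|P| (\prod_(i | P i) F i) (\prod_(i | P i) G i).
Proof.
move=> h; rewrite -sum1_card.
apply: (big_rec3 (fun x y k => top_form k y x)); first exact: top_form1.
by move=> i k y x Pi t; rewrite addnC mulrC [G i * _]mulrC; apply: top_formM => //; exact: h.
Qed.

Lemma top_form_sign d (e : nat) f g : top_form d f g ->
  top_form d ((-1) ^+ e * f) ((-1) ^+ e * g).
Proof.
move=> t; rewrite -signr_odd; case: odd; rewrite ?expr1 ?expr0 ?mul1r //.
by rewrite !mulN1r; apply: top_formN.
Qed.

(** Homogeneous of degree [D - d], which forces [p = 0] when [D < d]: the
    coefficients of an element of degree [d] in a relation of degree [D]. *)
Definition hom d D p := if (d <= D)%N then p \is (D - d).-homog else p == 0.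

Definition hcomp d D p := if (d <= D)%N then H (D - d) p else 0.

Lemma homP d D p : hom d D (hcomp d D p).
Proof. rewrite /hom /hcomp; case: (d <= D)%N; rewrite ?eqxx ?pihomogP //. Qed.

Lemma hcomp_id d D p : hom d D p -> hcomp d D p = p.
Proof. by rewrite /hom /hcomp; case: ifP => _; [exact: pihomog_dE | move/eqP->]. Qed.

Lemma hom_msize d D p : hom d D p -> (msize p <= D.+1 - d)%N.
Proof.
rewrite /hom; case: ifP => [le /dhomog_msize_leq|_ /eqP->]; last by rewrite msize0.
by rewrite subSn.
Qed.

Lemma homD d D p q : hom d D p -> hom d D q -> hom d D (p + q).
Proof.
rewrite /hom; case: ifP => _; first exact: dhomogD.
by move=> /eqP-> /eqP->; rewrite addr0.
Qed.

Lemma homN d D p : hom d D p -> hom d D (- p).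
Proof. by rewrite /hom; case: ifP => _; rewrite ?dhomogN ?oppr_eq0. Qed.

Lemma homM d e D g p : g \is e.-homog -> hom (d + e) D p -> hom d D (g * p).
Proof.
rewrite /hom => ge; case: ifP => [le|_ /eqP->]; last by rewrite mulr0 rpred0 eqxx; case: ifP.
rewrite (leq_trans (leq_addr e d) le) => hp.
have -> : (D - d = e + (D - (d + e)))%N by lia.
exact: dhomogM.
Qed.

Lemma hcompM d e D g p : g \is e.-homog -> hcomp d D (g * p) = g * hcomp (d + e) D p.
Proof.
move=> ge; rewrite /hcomp; case: (leqP (d + e) D) => h.
  rewrite (leq_trans (leq_addr e d) h).
  have -> : (D - d = e + (D - (d + e)))%N by lia.
  exact: pihomogM.
rewrite mulr0; case: ifP => // h1; apply: pihomogM_small ge _; lia.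
Qed.

Lemma hcompD d D p q : hcomp d D (p + q) = hcomp d D p + hcomp d D q.
Proof. by rewrite /hcomp; case: ifP => _; rewrite ?addr0 ?raddfD. Qed.

(** Cofactors of homogeneous relations can be chosen homogeneous, by taking
    components. *)
Lemma hom_factor d e D g p q : g \is e.-homog -> hom d D p -> p = g * q ->
  exists2 q', hom (d + e) D q' & p = g * q'.
Proof.
move=> ge hp pE; exists (hcomp (d + e) D q); first exact: homP.
by rewrite -hcompM // -pE hcomp_id.
Qed.

Lemma hom_factor2 d e1 e2 D g1 g2 p q1 q2 : g1 \is e1.-homog -> g2 \is e2.-homog ->
  hom d D p -> p = g1 * q1 + g2 * q2 ->
  exists q1' q2', [/\ hom (d + e1) D q1', hom (d + e2) D q2' & p = g1 * q1' + g2 * q2'].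
Proof.
move=> h1 h2 hp pE; exists (hcomp (d + e1) D q1), (hcomp (d + e2) D q2).
by split; rewrite ?homP // -!hcompM // -hcompD -pE hcomp_id.
Qed.

Lemma hcomp_rest d D p : (msize p <= D.+1 - d)%N -> (msize (p - hcomp d D p) <= D - d)%N.
Proof.
rewrite /hcomp; case: (leqP d D) => h le; last first.
  by rewrite subr0; apply: leq_trans le _; lia.
by apply: msize_sub_pihomog; rewrite -subSn.
Qed.

Lemma hcomp_topM d D f g p : top_form d f g -> (msize p <= D.+1 - d)%N ->
  H D (f * p) = g * hcomp d D p.
Proof.
case=> hg hf le.
have -> : f * p = g * p + (f - g) * p by ring.
have -> : H D (g * p + (f - g) * p) = H D (g * p) + H D ((f - g) * p) by rewrite raddfD.
have -> : H D (g * p) = hcomp 0 D (g * p) by rewrite /hcomp subn0.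
rewrite (hcompM 0 D p hg) add0n [H D ((f - g) * p)]pihomog_small ?addr0 //.
have [->|p0] := eqVneq p 0; first by rewrite mulr0 msize0.
have : (0 < msize p)%N by rewrite lt0n msize_poly_eq0.
move=> pp; apply: leq_trans (msizeM_leq hf le) _; lia.
Qed.

Lemma top_rest d e D f g p q : top_form e f g -> hom (d + e) D q ->
  (msize p <= D.+1 - d)%N -> hcomp d D p = g * q -> (msize (p - f * q) <= D - d)%N.
Proof.
move=> [hg hf] hq hp pE.
have -> : p - f * q = (p - hcomp d D p) - (f - g) * q by rewrite pE; ring.
apply: msizeB_leq; first exact: hcomp_rest.
have [->|q0] := eqVneq q 0; first by rewrite mulr0 msize0.
have hs := hom_msize hq.
have : (0 < msize q)%N by rewrite lt0n msize_poly_eq0.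
move=> pp; apply: leq_trans (msizeM_leq hf hs) _; lia.
Qed.

Lemma top_rest2 d e1 e2 D f1 g1 f2 g2 p q1 q2 : top_form e1 f1 g1 -> top_form e2 f2 g2 ->
  hom (d + e1) D q1 -> hom (d + e2) D q2 ->
  (msize p <= D.+1 - d)%N -> hcomp d D p = g1 * q1 + g2 * q2 ->
  (msize (p - f1 * q1 - f2 * q2) <= D - d)%N.
Proof.
move=> t1 t2 h1 h2 hp pE.
have -> : p - f1 * q1 - f2 * q2 =
    (p - hcomp d D p) + (g1 * q1 - f1 * q1) + (g2 * q2 - f2 * q2) by rewrite pE; ring.
have hcM e (g q : S) : g \is e.-homog -> hom (d + e) D q -> hcomp d D (g * q) = g * q.
  by move=> hg hq; rewrite (hcompM d D q hg) hcomp_id.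
have szM e (f g q : S) : top_form e f g -> hom (d + e) D q -> (msize (g * q) <= D.+1 - d)%N.
  by move=> [hg _] hq; apply: hom_msize; apply: homM hq.
apply: msizeD_leq; first apply: msizeD_leq.
- exact: hcomp_rest.
- apply: (top_rest t1 h1); first exact: szM t1 h1.
  exact: hcM t1.1 h1.
- apply: (top_rest t2 h2); first exact: szM t2 h2.
  exact: hcM t2.1 h2.
Qed.

(** Induction on the degree [D] of the relation [f2 a = f1 b]: its part of degree
    [D] is a relation between the top forms, hence a multiple of the trivial one,
    and subtracting this multiple lowers the degree. *)
Lemma nzd_mod_top d1 d2 f1 f2 g1 g2 : g1 != 0 ->
  top_form d1 f1 g1 -> top_form d2 f2 g2 -> nzd_mod g2 g1 -> nzd_mod f2 f1.
Proof.
move=> g10 t1 t2 reg.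
suff main D : forall a b, (msize a <= D - d2)%N -> (msize b <= D - d1)%N ->
    f2 * a = f1 * b -> exists c, a = f1 * c.
  move=> a b; apply: (main (msize a + msize b + d1 + d2)%N); lia.
elim: D => [|D IH] a b ha hb e.
  exists 0; rewrite mulr0; apply/eqP; rewrite -msize_poly_eq0; lia.
have ea := hcomp_topM t2 ha; have eb := hcomp_topM t1 hb.
rewrite e eb in ea.
have [c0 c0E] := reg _ _ (esym ea).
have [c hc cE] := hom_factor t1.1 (homP d2 D a) c0E.
have bE : hcomp d1 D b = g2 * c.
  by apply: (mulfI g10); rewrite ea cE; ring.
rewrite addnC in hc.
have hc' : hom (d2 + d1) D c by rewrite addnC.
have [c' c'E] : exists c', a - f1 * c = f1 * c'.
  apply: (IH _ (b - f2 * c)).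
  - exact: top_rest t1 hc' ha cE.
  - exact: top_rest t2 hc hb bE.
  - by rewrite !mulrBr e; ring.
by exists (c + c'); rewrite mulrDr -c'E; ring.
Qed.

(** Same induction. The part of degree [D] of the relation is a combination, with
    coefficients [l], [k] and [mu], of the three trivial relations between two of
    the top forms. *)
Lemma nzd_mod2_top d1 d2 d3 f1 f2 f3 g1 g2 g3 : g1 != 0 ->
  top_form d1 f1 g1 -> top_form d2 f2 g2 -> top_form d3 f3 g3 ->
  nzd_mod g2 g1 -> nzd_mod2 g3 g2 g1 -> nzd_mod2 f3 f2 f1.
Proof.
move=> g10 t1 t2 t3 reg2 reg3.
suff main D : forall a b c, (msize a <= D - d3)%N -> (msize b <= D - d2)%N ->
    (msize c <= D - d1)%N -> f3 * a = f2 * b + f1 * c ->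
    exists b' c', a = f2 * b' + f1 * c'.
  move=> a b c; apply: (main (msize a + msize b + msize c + d1 + d2 + d3)%N); lia.
elim: D => [|D IH] a b c ha hb hc e.
  exists 0, 0; rewrite !mulr0 addr0; apply/eqP; rewrite -msize_poly_eq0; lia.
have ea := hcomp_topM t3 ha; have eb := hcomp_topM t2 hb; have ec := hcomp_topM t1 hc.
have {ea} ea : g3 * hcomp d3 D a = g2 * hcomp d2 D b + g1 * hcomp d1 D c.
  by rewrite -ea -eb -ec e raddfD.
have [l0 [k0 aE0]] := reg3 _ _ _ ea.
have [l [k [hl hk aE]]] := hom_factor2 t2.1 t1.1 (homP d3 D a) aE0.
have hl' : hom (d2 + d3) D l by rewrite addnC.
have hk' : hom (d1 + d3) D k by rewrite addnC.
have e1 : g2 * (hcomp d2 D b - g3 * l) = g1 * (g3 * k - hcomp d1 D c).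
  have -> : g2 * (hcomp d2 D b - g3 * l) = g2 * hcomp d2 D b + g1 * hcomp d1 D c
    - g1 * hcomp d1 D c - g2 * g3 * l by ring.
  by rewrite -ea aE; ring.
have [mu0 mu0E] := reg2 _ _ e1.
have hb' : hom d2 D (hcomp d2 D b - g3 * l).
  by apply: homD; [exact: homP | apply: homN; apply: homM hl'; case: t3].
have [mu hmu muE] := hom_factor t1.1 hb' mu0E.
have hmu' : hom (d1 + d2) D mu by rewrite addnC.
have bE : hcomp d2 D b = g3 * l + g1 * mu by rewrite -muE; ring.
have cE : hcomp d1 D c = g3 * k + g2 * (- mu).
  have : g3 * k - hcomp d1 D c = g2 * mu.
    by apply: (mulfI g10); rewrite -e1 muE; ring.
  by move=> h; rewrite mulrN -h; ring.
have [b' [c' E]] : exists b' c', a - f2 * l - f1 * k = f2 * b' + f1 * c'.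
  apply: (IH _ (b - f3 * l - f1 * mu) (c - f3 * k - f2 * (- mu))).
  - exact: top_rest2 t2 t1 hl hk ha aE.
  - exact: top_rest2 t3 t1 hl' hmu hb bE.
  - exact: top_rest2 t3 t2 hk' (homN hmu') hc cE.
  - have -> : f3 * (a - f2 * l - f1 * k) = f3 * a - f3 * f2 * l - f3 * f1 * k by ring.
    by rewrite e; ring.
exists (l + b'), (k + c').
have -> : a = (a - f2 * l - f1 * k) + f2 * l + f1 * k by ring.
by rewrite E; ring.
Qed.

End TopForms.

Lemma nzd_mod_sign (S : idomainType) (g f f' : S) (e : bool) :
  f' = (-1) ^+ e * f -> nzd_mod g f -> nzd_mod g f'.
Proof.
move=> -> r a b e1; have [c cE] : exists c, a = f * c.
  by apply: (r _ ((-1) ^+ e * b)); rewrite e1; ring.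
by exists ((-1) ^+ e * c); rewrite cE; case: e {e1}; rewrite /= ?expr1 ?expr0; ring.
Qed.

Lemma nzd_mod2_sign (S : idomainType) (g h f f' : S) (e : bool) :
  f' = (-1) ^+ e * f -> nzd_mod2 g h f -> nzd_mod2 g h f'.
Proof.
move=> -> r a b c e1; have [d [d' dE]] : exists d d', a = h * d + f * d'.
  by apply: (r _ b ((-1) ^+ e * c)); rewrite e1; ring.
by exists d, ((-1) ^+ e * d'); rewrite dE; case: e {e1}; rewrite /= ?expr1 ?expr0; ring.
Qed.

Lemma mpoly_morph_eq N (k : comNzRingType) (T : comNzRingType)
    (F G : {rmorphism {mpoly k[N]} -> T}) :
  (forall c, F c%:MP = G c%:MP) -> (forall i, F 'X_i = G 'X_i) -> F =1 G.
Proof.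
move=> eC eX p; rewrite [p]mpolyE !rmorph_sum; apply: eq_bigr => mm _.
rewrite -mul_mpolyC !rmorphM /= eC mpolyXE_id !rmorph_prod; congr (_ * _).
by apply: eq_bigr => i _; rewrite !rmorphXn /= eX.
Qed.

(** * Setting a variable to zero *)

Section Kill.
Variables (n : nat) (A : idomainType).
Local Notation S := {mpoly A[n]}.
Implicit Types (i j : 'I_n) (p g f : S).

Definition kill i : S -> S :=
  mmap (@mpolyC n A) (fun j => if j == i then 0 else 'X_j).

HB.instance Definition _ i := GRing.RMorphism.copy (kill i)
  (mmap (@mpolyC n A) (fun j => if j == i then 0 else 'X_j)).

Lemma killX i j : kill i 'X_j = if j == i then 0 else 'X_j.
Proof. by rewrite /kill mmapX mmap1U. Qed.

Lemma kill_rest i p : exists q, p = kill i p + 'X_i * q.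
Proof.
pose P p := exists q, p = kill i p + 'X_i * q.
have PM f g : P f -> P g -> P (f * g).
  case=> f' fE [g' gE]; exists (kill i f * g' + f' * g).
  by rewrite rmorphM /=; move: (kill i f) (kill i g) fE gE => F G -> ->; ring.
have PX (c : A) (mm : 'X_{1..n}) : P (c *: 'X_[mm]).
  rewrite -mul_mpolyC; apply: (PM).
    by exists 0; rewrite /kill mmapC mulr0 addr0.
  rewrite mpolyXE_id; apply: big_ind; [by exists 0; rewrite rmorph1 mulr0 addr0 | exact: PM |].
  move=> j _; elim: (mm j) => [|d IH]; first by exists 0; rewrite expr0 rmorph1 mulr0 addr0.
  rewrite exprS; apply: (PM) => //; rewrite /P killX; case: eqP => [->|_].
    by exists 1; rewrite add0r mulr1.
  by exists 0; rewrite mulr0 addr0.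
elim/mpolyind: p => [|c mm p _ _ [q ->]]; first by exists 0; rewrite rmorph0 mulr0 addr0.
have [q' qE] := PX c mm; exists (q' + q).
rewrite rmorphD rmorphD rmorphM /= killX eqxx mul0r addr0.
have kk : kill i (kill i p) = kill i p.
  pose K : {rmorphism S -> S} := kill i.
  apply: (@mpoly_morph_eq n A S (K \o K) K) => [c'|j] /=; first by rewrite /kill !mmapC.
  by rewrite killX; case: eqP => [|/eqP ji]; rewrite ?rmorph0 ?killX ?(negPf ji).
rewrite kk {1}qE; ring.
Qed.

Lemma kill_nzd i g : kill i g != 0 -> nzd_mod g 'X_i.
Proof.
move=> g0 a b /(congr1 (kill i)); rewrite !rmorphM /= killX eqxx mul0r => /eqP.
rewrite mulf_eq0 (negPf g0) /= => /eqP a0; have [q qE] := kill_rest i a.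
by exists q; rewrite qE a0 add0r.
Qed.

Lemma mpolyX_neq0 j : 'X_j != 0 :> S.
Proof.
apply/eqP => /(congr1 (mcoeff U_(j)%MM)).
by rewrite mcoeffXU eqxx mcoeff0 => /eqP; rewrite oner_eq0.
Qed.

(** Modulo ['X_i], [g2] is a power of ['X_j] up to sign, so that it is enough to set
    both variables to zero in [g3]. *)
Lemma kill_nzd2 i j g2 g3 (e : bool) N : kill i g2 = (-1) ^+ e * 'X_j ^+ N ->
  kill j (kill i g3) != 0 -> nzd_mod2 g3 g2 'X_i.
Proof.
move=> g2E g30 a b c /(congr1 (kill i)).
rewrite rmorphD !rmorphM /= killX eqxx mul0r addr0 g2E mulrAC [_ * 'X_j ^+ N]mulrC => e1.
have [d dE] := nzd_mod_exp (n := N) (mpolyX_neq0 j) (kill_nzd g30) e1.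
have [q qE] := kill_rest i a; have [q2 q2E] := kill_rest i g2.
exists ((-1) ^+ e * d), (q - q2 * ((-1) ^+ e * d)).
have xjE : 'X_j ^+ N = (-1) ^+ e * (g2 - 'X_i * q2).
  by rewrite [in RHS]q2E g2E addrK signrMK.
by rewrite {1}qE dE xjE; ring.
Qed.

End Kill.

(** * The perturbing matrices *)

Section Specialization.
Variables (S : comNzRingType) (m : nat) (y sg tau : S).

(** Bidiagonal, so that the first and last maximal minors are powers of [sg] and of
    [tau]. *)
Definition specX : 'M[S]_(m.+1, m) :=
  \matrix_(i, j) ((if i == j :> nat then tau else 0) + (if i == j.+1 :> nat then sg else 0)).

(** The edges with label [y] are a perfect matching, joining 2t and 2t+1. The others
    form a path 2, 1, 4, 3, ..., m-1, m-2, m, with labels [tau] and [sg] in turn.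
    The matching condition is that 2t has no other neighbour above it, so the
    Pfaffian is a power of [y] up to sign. For [y = 0] the vertex 0 is isolated, and
    the path without its first vertex 2 (respectively its last vertex m) has one
    perfect matching, with all labels [sg] (respectively [tau]). *)
Definition specb (i j : nat) : S :=
  if (i < j)%N then
    if odd i then
      if j == i.+1 then tau
      else if (j == i.+3) || (j == i.+2) && (j == m) then sg else 0
    else if j == i.+1 then y else 0
  else 0.

Definition specB : 'M[S]_m.+1 := \matrix_(i, j) (specb i j - specb j i).

Lemma specB_alt : alternating_mx specB.
Proof. by split=> [i|i j]; rewrite !mxE ?subrr // opprB. Qed.

Lemma specb_ge i j : (j <= i)%N -> specb i j = 0.
Proof. by rewrite /specb leqNgt => /negbTE ->. Qed.

Lemma specB_lt (i j : 'I_m.+1) : (i < j)%N -> specB i j = specb i j.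
Proof. by move=> lt; rewrite mxE (specb_ge (ltnW lt)) subr0. Qed.

Lemma specB_eq0 (i j : 'I_m.+1) : (i <= j)%N -> specb i j = 0 -> specB i j = 0.
Proof. by move=> lt b0; rewrite mxE (specb_ge lt) b0 subr0. Qed.

Variable s : nat.
Hypothesis nE : m.+1 = s.*2.

(** The vertex 2t is a leaf attached to 2t+1. *)
Lemma pfs_spec_y t : (t <= s)%N -> exists e : bool,
  pfs specB [set x : 'I_m.+1 | (t.*2 <= x)%N] = (-1) ^+ e * y ^+ (s - t).
Proof.
move=> ts; rewrite -(subKn ts); move: (s - t)%N (leq_subr t s) => {ts}{}t.
elim: t => [|t IH] ts.
  exists false; rewrite subn0 subnn mulr1 (_ : [set _ | _] = set0) ?pfs0 //.
  by apply/setP => x; rewrite !inE -nE leqNgt ltn_ord.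
have [e eE] := IH (ltnW ts).
have i_lt : ((s - t.+1).*2 < m.+1)%N by lia.
have j_lt : ((s - t.+1).*2.+1 < m.+1)%N by lia.
set K := [set _ | _].
have iK : Ordinal i_lt \in K by rewrite inE.
have jK : Ordinal j_lt \in K by rewrite inE /=.
have ji : Ordinal j_lt != Ordinal i_lt by rewrite -val_eqE /= gtn_eqF.
have [|e' ->] := pfs_leaf specB_alt iK jK ji.
  move=> x; rewrite !inE -val_eqE /= => ge xj; apply: specB_eq0 => //=.
  by rewrite /specb odd_double (negPf xj); case: ifP.
exists (e' (+) e).
rewrite (_ : _ :\ _ :\ _ = [set x : 'I_m.+1 | ((s - t).*2 <= x)%N]); last first.
  by apply/setP => x; rewrite !inE -!val_eqE /=; lia.
rewrite eE specB_lt //= /specb ltnS leqnn odd_double eqxx !subKn //; last exact: ltnW.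
by rewrite signr_addb exprS; ring.
Qed.

(** The vertex 2t-1 has lost its neighbour 2t; it is a leaf attached to 2t+2, or to
    [m] in the last step. For [t = 1] the set is the complement of 0 and 2. *)
Lemma pfs_spec_sg t : (0 < t)%N -> (t < s)%N -> y = 0 -> exists e : bool,
  pfs specB [set x : 'I_m.+1 | (t.*2 <= x.+1)%N && (x != t.*2 :> nat)] =
    (-1) ^+ e * sg ^+ (s - t).
Proof.
move=> t0 ts y0; have [d dE] : {d | s = (t + d.+1)%N} by exists (s - t).-1; lia.
elim: d t t0 ts dE => [|d IH] t t0 ts dE.
  have i_lt : (t.*2.-1 < m.+1)%N by lia.
  have j_lt : (t.*2.+1 < m.+1)%N by lia.
  have oddi : odd t.*2.-1 by case: (t) t0 => // t' _; rewrite doubleS /= odd_double.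
  set K := [set _ | _].
  have iK : Ordinal i_lt \in K by rewrite inE /=; lia.
  have jK : Ordinal j_lt \in K by rewrite inE /=; lia.
  have ji : Ordinal j_lt != Ordinal i_lt by rewrite -val_eqE /=; lia.
  have [|e ->] := pfs_leaf specB_alt iK jK ji.
    move=> x; rewrite !inE -val_eqE /= => ge xj; apply: specB_eq0 => /=; first by lia.
    rewrite /specb oddi; have := ltn_ord x => xm.
    case: ifP => // _; rewrite ifF; last by lia.
    by rewrite ifF //; lia.
  exists e; rewrite (_ : _ :\ _ :\ _ = set0); last first.
    by apply/setP => x; rewrite !inE -!val_eqE /=; have := ltn_ord x; lia.
  rewrite pfs0 mulr1 specB_lt /=; last by lia.
  rewrite /specb ifT; last by lia.
  rewrite oddi ifF; last by lia.
  rewrite ifT; last by lia.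
  by congr (_ * _); rewrite dE addKn.
have [e eE] := IH t.+1 isT ltac:(lia) ltac:(lia).
have i_lt : (t.*2.-1 < m.+1)%N by lia.
have j_lt : (t.*2.+2 < m.+1)%N by lia.
have oddi : odd t.*2.-1 by case: (t) t0 => // t' _; rewrite doubleS /= odd_double.
set K := [set _ | _].
have iK : Ordinal i_lt \in K by rewrite inE /=; lia.
have jK : Ordinal j_lt \in K by rewrite inE /=; lia.
have ji : Ordinal j_lt != Ordinal i_lt by rewrite -val_eqE /=; lia.
have [|e' ->] := pfs_leaf specB_alt iK jK ji.
  move=> x; rewrite !inE -val_eqE /= => ge xj; apply: specB_eq0 => /=; first by lia.
  rewrite /specb oddi; have := ltn_ord x => xm.
  case: ifP => // _; rewrite ifF; last by lia.
  by rewrite ifF //; lia.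
exists (e' (+) e).
rewrite (_ : _ :\ _ :\ _ = [set x : 'I_m.+1 | (t.+1.*2 <= x.+1)%N && (x != t.+1.*2 :> nat)]);
  last by apply/setP => x; rewrite !inE -!val_eqE /=; lia.
rewrite eE specB_lt /=; last by lia.
rewrite /specb ifT; last by lia.
rewrite oddi ifF; last by lia.
rewrite ifT; last by lia.
rewrite signr_addb (_ : (s - t = (s - t.+1).+1)%N) ?exprS; last by lia.
by ring.
Qed.

(** The vertex 2t-1 is a leaf attached to 2t. For [t = 1] the set is the complement
    of 0 and m. *)
Lemma pfs_spec_tau t : (0 < t)%N -> (t <= s)%N -> sg = 0 -> exists e : bool,
  pfs specB [set x : 'I_m.+1 | (t.*2 <= x.+1)%N && (x != m :> nat)] =
    (-1) ^+ e * tau ^+ (s - t).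
Proof.
move=> t0 ts s0; have [d dE] : {d | s = (t + d)%N} by exists (s - t)%N; lia.
elim: d t t0 ts dE => [|d IH] t t0 ts dE.
  exists false; rewrite (_ : [set _ | _] = set0) ?pfs0; last first.
    by apply/setP => x; rewrite !inE; have := ltn_ord x; lia.
  by rewrite (_ : (s - t)%N = 0%N) ?mulr1 //; lia.
have [e eE] := IH t.+1 isT ltac:(lia) ltac:(lia).
have i_lt : (t.*2.-1 < m.+1)%N by lia.
have j_lt : (t.*2 < m.+1)%N by lia.
have oddi : odd t.*2.-1 by case: (t) t0 => // t' _; rewrite doubleS /= odd_double.
set K := [set _ | _].
have iK : Ordinal i_lt \in K by rewrite inE /=; lia.
have jK : Ordinal j_lt \in K by rewrite inE /=; lia.
have ji : Ordinal j_lt != Ordinal i_lt by rewrite -val_eqE /=; lia.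
have [|e' ->] := pfs_leaf specB_alt iK jK ji.
  move=> x; rewrite !inE -val_eqE /= => ge xj; apply: specB_eq0 => /=; first by lia.
  by rewrite /specb oddi s0; case: ifP => // _; rewrite ifF ?if_same //; lia.
exists (e' (+) e).
rewrite (_ : _ :\ _ :\ _ = [set x : 'I_m.+1 | (t.+1.*2 <= x.+1)%N && (x != m :> nat)]);
  last by apply/setP => x; rewrite !inE -!val_eqE /=; lia.
rewrite eE specB_lt /=; last by lia.
rewrite /specb ifT; last by lia.
rewrite oddi ifT; last by lia.
rewrite signr_addb (_ : (s - t = (s - t.+1).+1)%N) ?exprS; last by lia.
by ring.
Qed.

Lemma pfs_spec_row0 (K : {set 'I_m.+1}) : y = 0 -> ord0 \in K -> pfs specB K = 0.
Proof.
move=> y0 K0; apply: (pfs_isolated specB_alt K0) => x _; apply: specB_eq0 => //.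
by rewrite /specb y0 /= if_same; case: ifP.
Qed.

Lemma pfs_spec_rowmax (K : {set 'I_m.+1}) : y = 0 -> sg = 0 -> ord_max \in K -> pfs specB K = 0.
Proof.
move=> y0 s0 Km; apply: (pfs_isolated specB_alt Km) => x _.
rewrite specB_alt.2 specB_eq0 ?oppr0 //=; first by rewrite -ltnS.
rewrite /specb y0 s0; case: ifP => // _; case: ifP => [ox|_]; last by rewrite if_same.
rewrite ifF ?if_same //; lia.
Qed.

Lemma signed_minor_spec0 : signed_minor specX ord0 = sg ^+ m.
Proof.
rewrite /signed_minor expr0 mul1r -det_tr det_trig.
  transitivity (\prod_(i < m) sg); last by rewrite prodr_const card_ord.
  by apply: eq_bigr => i _; rewrite !mxE /= eqxx ifF ?add0r //= /bump /=; lia.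
apply/is_trig_mxP => -[i i_lt] [j j_lt] /= lt; rewrite !mxE /= /bump /=.
by rewrite ifF ?ifF ?addr0 //; lia.
Qed.

Lemma signed_minor_spec_max : signed_minor specX ord_max = - tau ^+ m.
Proof.
have -> : signed_minor specX ord_max = (-1) ^+ m * \det (row' ord_max specX) by [].
rewrite -signr_odd (_ : odd m = true) ?mulN1r; last by lia.
congr (- _); rewrite det_trig.
  transitivity (\prod_(i < m) tau); last by rewrite prodr_const card_ord.
  apply: eq_bigr => -[i i_lt] _; rewrite !mxE lift_max /= eqxx ifF ?addr0 //; lia.
apply/is_trig_mxP => -[i i_lt] [j j_lt] /= lt; rewrite !mxE lift_max /=.
by rewrite ifF ?ifF ?addr0 //; lia.
Qed.

End Specialization.

(** * Regularity for the perturbed matrices *)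

Lemma map_contr (R S : comNzRingType) (f : {rmorphism R -> S}) n (a : 'I_n -> R) F I :
  f (contr a F I) = contr (f \o a) (f \o F) I.
Proof.
by rewrite rmorph_sum; apply: eq_bigr => i _; rewrite !rmorphM /= rmorph_sign.
Qed.

Lemma map_signed_minor (R S : comNzRingType) (f : {rmorphism R -> S}) m
    (X : 'M[R]_(m.+1, m)) i :
  f (signed_minor X i) = signed_minor (map_mx f X) i.
Proof. by rewrite /signed_minor rmorphM rmorph_sign -det_map_mx map_row'. Qed.

Lemma map_top_u (R S : idomainType) (f : {rmorphism R -> S}) m
    (X : 'M[R]_(m.+1, m)) (B : 'M[R]_m.+1) r :
  f (top_u X B r) = top_u (map_mx f X) (map_mx f B) r.
Proof.
rewrite !top_uE rmorphM rmorph_sign; congr (_ * _); rewrite map_contr.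
apply: eq_bigr => i _; congr (_ * _ * _) => /=; first exact: map_signed_minor.
exact: map_pfs.
Qed.

(** A matching of [I] has half as many pairs as [I] has elements, hence Pfaffians
    are homogeneous. *)
Lemma card_matching n (s : 'S_n) (I : {set 'I_n}) : matching_on I s ->
  (#|[pred i : 'I_n | (i < s i)%N]|.*2 = #|I|)%N.
Proof.
move=> /matching_onP[sK sI]; rewrite -addnn.
have -> : #|I| = (#|[pred i : 'I_n | (i < s i)%N]| + #|[pred i : 'I_n | (s i < i)%N]|)%N.
  rewrite -[LHS](cardID [pred i : 'I_n | (i < s i)%N]); congr (_ + _)%N; apply: eq_card => i;
    by rewrite !inE sI -val_eqE; case: ltngtP.
congr (_ + _)%N; rewrite -(card_imset _ (@perm_inj _ s)); apply: eq_card => i.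
rewrite [RHS]inE; apply/imsetP/idP => [[j]|lt]; first by rewrite !inE => lt ->; rewrite sK.
by exists (s i); rewrite ?inE sK.
Qed.

Section TopFormsOfMinors.
Variables (n : nat) (A : idomainType).
Local Notation S := {mpoly A[n]}.

Lemma top_form_det k (M N : 'M[S]_k) : (forall i j, top_form 1 (M i j) (N i j)) ->
  top_form k (\det M) (\det N).
Proof.
move=> h; rewrite /determinant; apply: top_form_sum => s _; apply: top_form_sign.
by rewrite -[X in top_form X]card_ord; apply: top_form_prod => i _; exact: h.
Qed.

Lemma top_form_pfs k (M N : 'M[S]_k) (I : {set 'I_k}) t : #|I| = t.*2 ->
  (forall i j, top_form 1 (M i j) (N i j)) -> top_form t (pfs M I) (pfs N I).
Proof.
move=> cI h; apply: top_form_sum => s ms; apply: top_form_sign.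
have -> : t = #|[pred i : 'I_k | (i < s i)%N]|.
  by apply: double_inj; rewrite (card_matching ms) cI.
by apply: top_form_prod => i _; exact: h.
Qed.

Lemma top_form_signed_minor m (M N : 'M[S]_(m.+1, m)) i :
  (forall i j, top_form 1 (M i j) (N i j)) ->
  top_form m (signed_minor M i) (signed_minor N i).
Proof. by move=> h; apply: top_form_sign; apply: top_form_det => i' j; rewrite !mxE. Qed.

Lemma top_form_top_u m s (M N : 'M[S]_(m.+1, m)) (B C : 'M[S]_m.+1) r :
  m.+1 = s.*2 ->
  (forall i j, top_form 1 (M i j) (N i j)) -> (forall i j, top_form 1 (B i j) (C i j)) ->
  top_form (m + s.-1) (top_u M B r) (top_u N C r).
Proof.
move=> nE hX hB; rewrite !top_uE; apply: top_form_sign.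
apply: top_form_sum => i; rewrite inE => ir; apply: top_formM.
  exact/top_form_sign/top_form_signed_minor.
apply: top_form_pfs => //.
have := cardsD1 i (~: [set r]); rewrite in_setC ir cardsC1 card_ord /=.
move: nE; lia.
Qed.

Lemma top_form_neq0 d (f g : S) : top_form d f g -> g != 0 -> f != 0.
Proof.
move=> [hg hf]; apply: contraNneq => f0; rewrite f0 sub0r msizeN in hf.
by rewrite -(pihomog_dE hg) (pihomog_small hf).
Qed.

End TopFormsOfMinors.

Lemma map_specX (S T : comNzRingType) (f : {rmorphism S -> T}) m sg tau :
  map_mx f (specX m sg tau) = specX m (f sg) (f tau).
Proof.
by apply/matrixP => i j; rewrite !mxE rmorphD /= !(fun_if f) rmorph0.
Qed.

Lemma map_specb (S T : comNzRingType) (f : {rmorphism S -> T}) m y sg tau i j :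
  f (specb m y sg tau i j) = specb m (f y) (f sg) (f tau) i j.
Proof. by rewrite /specb !(fun_if f) rmorph0. Qed.

Lemma map_specB (S T : comNzRingType) (f : {rmorphism S -> T}) m y sg tau :
  map_mx f (specB m y sg tau) = specB m (f y) (f sg) (f tau).
Proof.
apply/matrixP => i j; by rewrite !mxE rmorphB /= !map_specb.
Qed.

Section SpecializedRegularity.
Variables (A : idomainType) (m s : nat).
Hypotheses (s_ge2 : (2 <= s)%N) (nE : m.+1 = s.*2).
Variables (X0 : 'M[A]_(m.+1, m)) (B0 : 'M[A]_m.+1).
Local Notation S := {mpoly A[3]}.
Local Notation iy := (@Ordinal 3 0 isT).
Local Notation isg := (@Ordinal 3 1 isT).
Local Notation itau := (@Ordinal 3 2 isT).
Local Notation y := ('X_iy : S).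
Local Notation sg := ('X_isg : S).
Local Notation tau := ('X_itau : S).

Definition pertX : 'M[S]_(m.+1, m) := map_mx (@mpolyC 3 A) X0 + specX m sg tau.
Definition pertB : 'M[S]_m.+1 := map_mx (@mpolyC 3 A) B0 + specB m y sg tau.

Fact two_lt : (2 < m.+1)%N. Proof. by rewrite nE -[2%N]/(1.*2) ltn_double. Qed.
Definition ord_two := Ordinal two_lt.

Let top_add (c : A) (g : S) : g \is 1.-homog -> top_form 1 (c%:MP + g) g.
Proof.
move=> hg; split=> //; rewrite addrK mmeasureC.
by case: (c != 0).
Qed.

Let homX (i : 'I_3) : ('X_i : S) \is 1.-homog.
Proof. by rewrite dhomogX /= mdeg1. Qed.

Let hom_if (b : bool) (g h : S) : g \is 1.-homog -> h \is 1.-homog ->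
  (if b then g else h) \is 1.-homog.
Proof. by case: b. Qed.

Let topX i j : top_form 1 (pertX i j) (specX m sg tau i j).
Proof.
rewrite !mxE; apply: top_add; apply: dhomogD; apply: hom_if; rewrite ?homX ?dhomog0 //.
Qed.

Let topB i j : top_form 1 (pertB i j) (specB m y sg tau i j).
Proof.
have hb k l : specb m y sg tau k l \is 1.-homog.
  by rewrite /specb; do 5?[apply: hom_if; rewrite ?homX ?dhomog0 //].
rewrite !mxE; apply: top_add; apply: dhomogD => //; rewrite dhomogN //.
Qed.

Let top_pf : top_form s (pfs pertB setT) (pfs (specB m y sg tau) setT).
Proof. by apply: top_form_pfs; rewrite ?cardsT ?card_ord. Qed.

Let topY i : top_form m (signed_minor pertX i) (signed_minor (specX m sg tau) i).
Proof. exact: top_form_signed_minor. Qed.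

Let topU i : top_form (m + s.-1) (top_u pertX pertB i)
  (top_u (specX m sg tau) (specB m y sg tau) i).
Proof. exact: top_form_top_u nE topX topB. Qed.

Let killE i j : kill i ('X_j : S) = if j == i then 0 else 'X_j.
Proof. exact: killX. Qed.

Let spec_pf : exists e : bool, pfs (specB m y sg tau) setT = (-1) ^+ e * y ^+ s.
Proof.
have [e eE] := pfs_spec_y y sg tau nE (leq0n s); exists e; rewrite subn0 in eE.
by rewrite -eE; congr pfs; apply/setP => x; rewrite !inE.
Qed.

Let spec_pf_neq0 : pfs (specB m y sg tau) setT != 0.
Proof.
by have [e ->] := spec_pf; rewrite mulf_neq0 ?signr_eq0 ?expf_neq0 ?mpolyX_neq0.
Qed.

Let kill_y_u i : kill iy (top_u (specX m sg tau) (specB m y sg tau) i) =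
  top_u (specX m sg tau) (specB m 0 sg tau) i.
Proof. by rewrite map_top_u map_specX map_specB /= !killE. Qed.

Let kill_sg_u i : kill isg (top_u (specX m sg tau) (specB m 0 sg tau) i) =
  top_u (specX m 0 tau) (specB m 0 0 tau) i.
Proof. by rewrite map_top_u map_specX map_specB /= !killE rmorph0. Qed.

(** For [y = 0] only the term of u_2 that removes the isolated vertex 0 remains. *)
Let spec_u2 : exists e : bool,
  kill iy (top_u (specX m sg tau) (specB m y sg tau) ord_two) = (-1) ^+ e * sg ^+ (m + s.-1).
Proof.
rewrite kill_y_u top_uE /contr.
rewrite (bigD1 ord0) ?inE //= big1 ?addr0 => [|i /andP[]]; last first.
  rewrite !inE => i2 i0; rewrite pfs_spec_row0 ?mulr0 // !inE /=.
  by rewrite eq_sym i0.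
rewrite (signed_minor_spec0 _ _ nE).
have [e eE] := pfs_spec_sg sg tau nE (ltn0Sn 0) s_ge2 (erefl 0).
rewrite (_ : ~: [set ord_two] :\ ord0 =
  [set x : 'I_m.+1 | (1.*2 <= x.+1)%N && (x != 1.*2 :> nat)]); last first.
  by apply/setP => x; rewrite !inE -!val_eqE /=; lia.
rewrite eE subn1 exprD.
set k := rank_in _ _.
exists (~~ (odd k (+) e)); rewrite signrN signr_addb signr_odd.
by move: ((-1) ^+ k) ((-1) ^+ e) => a b; ring.
Qed.

(** For [y = sg = 0] the vertex m is isolated as well. *)
Let spec_u0 :
  kill isg (kill iy (top_u (specX m sg tau) (specB m y sg tau) ord0)) != 0.
Proof.
rewrite kill_y_u kill_sg_u top_uE /contr.
have m0 : ord_max != ord0 :> 'I_m.+1 by rewrite -val_eqE /=; lia.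
rewrite (bigD1 ord_max) ?inE //= big1 ?addr0 => [|i /andP[]]; last first.
  rewrite !inE => i2 i0; rewrite (@pfs_spec_rowmax _ _ _ _ _ _ nE) ?mulr0 // !inE /=.
  by rewrite eq_sym i0.
rewrite (signed_minor_spec_max _ _ nE).
have [e eE] := pfs_spec_tau 0 tau nE (ltn0Sn 0) (ltnW s_ge2) (erefl 0).
rewrite (_ : ~: [set ord0] :\ ord_max =
  [set x : 'I_m.+1 | (1.*2 <= x.+1)%N && (x != m :> nat)]); last first.
  by apply/setP => x; rewrite !inE -!val_eqE /=; lia.
rewrite eE; apply: mulf_neq0; first by rewrite signr_eq0.
apply: mulf_neq0; apply: mulf_neq0; rewrite ?signr_eq0 ?oppr_eq0 //.
  by rewrite expf_neq0 ?mpolyX_neq0.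
by rewrite expf_neq0 ?mpolyX_neq0.
Qed.

Lemma pert_pf_neq0 : pfs pertB setT != 0.
Proof. exact: top_form_neq0 top_pf spec_pf_neq0. Qed.

Lemma pert_Y0_neq0 : signed_minor pertX ord0 != 0.
Proof.
apply: top_form_neq0 (topY _) _.
by rewrite (signed_minor_spec0 _ _ nE) expf_neq0 ?mpolyX_neq0.
Qed.

Lemma pert_Ymax_neq0 : signed_minor pertX ord_max != 0.
Proof.
apply: top_form_neq0 (topY _) _.
by rewrite (signed_minor_spec_max _ _ nE) oppr_eq0 expf_neq0 ?mpolyX_neq0.
Qed.

Lemma pert_reg_Y : nzd_mod (signed_minor pertX ord_max) (signed_minor pertX ord0).
Proof.
apply: nzd_mod_top (topY _) (topY _) _; rewrite (signed_minor_spec0 _ _ nE).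
  by rewrite expf_neq0 ?mpolyX_neq0.
apply: nzd_mod_exp; first exact: mpolyX_neq0.
apply: kill_nzd; rewrite (signed_minor_spec_max _ _ nE) rmorphN rmorphXn /= killE /=.
by rewrite oppr_eq0 expf_neq0 ?mpolyX_neq0.
Qed.

Lemma pert_reg_Y_pf : nzd_mod (signed_minor pertX ord_max) (pfs pertB setT).
Proof.
apply: nzd_mod_top spec_pf_neq0 top_pf (topY _) _.
have [e eE] := spec_pf; apply: nzd_mod_sign eE _.
apply: nzd_mod_exp; first exact: mpolyX_neq0.
apply: kill_nzd; rewrite (signed_minor_spec_max _ _ nE) rmorphN rmorphXn /= killE /=.
by rewrite oppr_eq0 expf_neq0 ?mpolyX_neq0.
Qed.

Let spec_reg_u_y : nzd_mod (top_u (specX m sg tau) (specB m y sg tau) ord_two) y.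
Proof.
apply: kill_nzd; have [e ->] := spec_u2.
by rewrite mulf_neq0 ?signr_eq0 ?expf_neq0 ?mpolyX_neq0.
Qed.

Let spec_reg_u_pf : nzd_mod (top_u (specX m sg tau) (specB m y sg tau) ord_two)
  (pfs (specB m y sg tau) setT).
Proof.
have [e eE] := spec_pf; apply: nzd_mod_sign eE _.
by apply: nzd_mod_exp; [exact: mpolyX_neq0 | exact: spec_reg_u_y].
Qed.

Lemma pert_reg_u_pf : nzd_mod (top_u pertX pertB ord_two) (pfs pertB setT).
Proof. exact: nzd_mod_top spec_pf_neq0 top_pf (topU _) spec_reg_u_pf. Qed.

Lemma pert_reg_uu_pf :
  nzd_mod2 (top_u pertX pertB ord0) (top_u pertX pertB ord_two) (pfs pertB setT).
Proof.
apply: nzd_mod2_top spec_pf_neq0 top_pf (topU _) (topU _) spec_reg_u_pf _.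
have [e eE] := spec_pf; apply: nzd_mod2_sign eE _.
apply: nzd_mod2_exp; [exact: mpolyX_neq0 | exact: spec_reg_u_y |].
have [e2 e2E] := spec_u2.
exact: kill_nzd2 e2E spec_u0.
Qed.

End SpecializedRegularity.

(** * Descent to the generic ring *)

Section Retraction.
Variables (R S : idomainType) (phi : {rmorphism R -> S}) (psi : {rmorphism S -> R}).
Hypothesis phiK : cancel phi psi.

Lemma nzd_mod_retract g f : nzd_mod (phi g) (phi f) -> nzd_mod g f.
Proof.
move=> r a b /(congr1 phi); rewrite !rmorphM => /r [c cE].
by exists (psi c); rewrite -[LHS]phiK cE rmorphM phiK.
Qed.

Lemma nzd_mod2_retract g f e : nzd_mod2 (phi g) (phi f) (phi e) -> nzd_mod2 g f e.
Proof.
move=> r a b c /(congr1 phi); rewrite rmorphD !rmorphM => /r [d [d' dE]].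
by exists (psi d), (psi d'); rewrite -[LHS]phiK dE rmorphD !rmorphM !phiK.
Qed.

Lemma neq0_morph f : phi f != 0 -> f != 0.
Proof. by apply: contraNneq => ->; rewrite rmorph0. Qed.

End Retraction.

Section GenericRegularity.
Variables (k : fieldType) (m s : nat).
Hypotheses (s_ge2 : (2 <= s)%N) (nE : m.+1 = s.*2).
Local Notation R := ({mpoly k[#|gen_var m|]} : idomainType).
Local Notation S := {mpoly R[3]}.
Local Notation X := (genX k m : 'M[R]_(m.+1, m)).
Local Notation B := (genB k m : 'M[R]_m.+1).
Local Notation iy := (@Ordinal 3 0 isT).
Local Notation isg := (@Ordinal 3 1 isT).
Local Notation itau := (@Ordinal 3 2 isT).

Definition perturb_var (v : 'I_#|gen_var m|) : S :=
  ('X_v : R)%:MP +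
  match enum_val v with
  | inl p => specX m 'X_isg 'X_itau p.1 p.2
  | inr p => specb m 'X_iy 'X_isg 'X_itau (val p).1 (val p).2
  end.

Definition perturb : {rmorphism R -> S} :=
  mmap (@mpolyC 3 R \o @mpolyC #|gen_var m| k) perturb_var.

(** Setting the three new variables to zero. *)
Definition restore : {rmorphism S -> R} := mmap (idfun : R -> R) (fun _ : 'I_3 => 0 : R).

Lemma restoreC c : restore c%:MP = c.
Proof. exact: mmapC. Qed.

Lemma restoreX i : restore 'X_i = 0.
Proof. by rewrite /= mmapX mmap1U. Qed.

Lemma perturbX v : perturb 'X_v = perturb_var v.
Proof. by rewrite /= mmapX mmap1U. Qed.

Lemma restore_perturb : cancel perturb restore.
Proof.
move=> p; pose F : {rmorphism R -> R} := restore \o perturb.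
pose G : {rmorphism R -> R} := idfun.
apply: (@mpoly_morph_eq _ k R F G) => [c|v].
  have -> : F c%:MP = restore (perturb c%:MP) by [].
  have -> : perturb c%:MP = (c%:MP : R)%:MP by exact: mmapC.
  by rewrite restoreC.
have -> : F 'X_v = restore (perturb 'X_v) by [].
rewrite perturbX rmorphD restoreC -[RHS]addr0; congr (_ + _).
case: (enum_val v) => q.
  by rewrite mxE rmorphD /= !fun_if !restoreX rmorph0 !if_same addr0.
by rewrite map_specb !restoreX /specb !if_same.
Qed.

Lemma perturb_genX : map_mx perturb X = pertX X.
Proof.
apply/matrixP => i j; rewrite [LHS]mxE [genX k m i j]mxE perturbX /perturb_var enum_rankK.
by rewrite !mxE.
Qed.

Lemma perturb_b_var i j : perturb (b_var k i j) =
  (b_var k i j : R)%:MP + specb m 'X_iy 'X_isg 'X_itau i j.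
Proof.
rewrite /b_var; case: insubP => [p _ pE|].
  by rewrite perturbX /perturb_var enum_rankK pE.
by rewrite -leqNgt => /= le; rewrite rmorph0 mpolyC0 specb_ge ?addr0.
Qed.

Lemma perturb_genB : map_mx perturb B = pertB B.
Proof.
apply/matrixP => i j; rewrite [LHS]mxE [genB k m i j]mxE rmorphB /= !perturb_b_var.
by rewrite !mxE rmorphB /=; ring.
Qed.

Lemma genB_alt : alternating_mx B.
Proof. by split=> [i|i j]; rewrite !mxE ?subrr ?opprB. Qed.

Lemma perturb_pf I : perturb (pfs B I) = pfs (pertB B) I.
Proof. by rewrite map_pfs perturb_genB. Qed.

Lemma perturb_Y i : perturb (signed_minor X i) = signed_minor (pertX X) i.
Proof. by rewrite map_signed_minor perturb_genX. Qed.

Lemma perturb_u i : perturb (top_u X B i) = top_u (pertX X) (pertB B) i.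
Proof. by rewrite map_top_u perturb_genX perturb_genB. Qed.

Lemma gen_pf_neq0 : pfs B setT != 0.
Proof. by apply: (@neq0_morph _ _ perturb); rewrite perturb_pf (pert_pf_neq0 nE). Qed.

Lemma gen_Y0_neq0 : signed_minor X ord0 != 0.
Proof. by apply: (@neq0_morph _ _ perturb); rewrite perturb_Y (pert_Y0_neq0 nE). Qed.

Lemma gen_Ymax_neq0 : signed_minor X ord_max != 0.
Proof. by apply: (@neq0_morph _ _ perturb); rewrite perturb_Y (pert_Ymax_neq0 nE). Qed.

Lemma gen_reg_Y : nzd_mod (signed_minor X ord_max) (signed_minor X ord0).
Proof.
have r := (@pert_reg_Y _ m s nE X); rewrite -!perturb_Y in r.
exact: (nzd_mod_retract restore_perturb r).
Qed.

Lemma gen_reg_Y_pf : nzd_mod (signed_minor X ord_max) (pfs B setT).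
Proof.
have r := (@pert_reg_Y_pf _ m s nE X B); rewrite -perturb_Y -perturb_pf in r.
exact: (nzd_mod_retract restore_perturb r).
Qed.

Lemma gen_reg_u_pf : nzd_mod (top_u X B (ord_two s_ge2 nE)) (pfs B setT).
Proof.
have r := (@pert_reg_u_pf _ m s s_ge2 nE X B); rewrite -perturb_u -perturb_pf in r.
exact: (nzd_mod_retract restore_perturb r).
Qed.

Lemma gen_reg_uu_pf :
  nzd_mod2 (top_u X B ord0) (top_u X B (ord_two s_ge2 nE)) (pfs B setT).
Proof.
have r := (@pert_reg_uu_pf _ m s s_ge2 nE X B); rewrite -!perturb_u -perturb_pf in r.
exact: (nzd_mod2_retract restore_perturb r).
Qed.

End GenericRegularity.

(** * Comparison with the stated formulas *)

Lemma lift_ltn_mono n (j : 'I_n) : {mono (lift j) : a b / (a < b)%N}.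
Proof. by move=> a b; rewrite /= /bump; lia. Qed.

Lemma subpfaffianE (R : comNzRingType) m (B : 'M[R]_m.+1) i j :
  alternating_mx B -> i != j -> subpfaffian B i j = pfs B (~: [set i; j]).
Proof.
move=> altB ij; rewrite /subpfaffian.
case: (unliftP j i) => [i' iE|e]; last by rewrite e eqxx in ij.
pose f := lift j \o lift i'.
have fm : {mono f : a b / (a < b)%N} by move=> a b; rewrite /f [LHS]lift_ltn_mono lift_ltn_mono.
have -> : row' i' (row' j (col' i' (col' j B))) = mxsub f f B.
  by apply/matrixP => a b; rewrite !mxE.
rewrite pfaffianE pfs_mxsub //; congr pfs.
apply/setP => x; rewrite !inE negb_or; apply/imsetP/andP => [[z _ ->]|[xi xj]].
  by rewrite iE /f /= (inj_eq lift_inj) ![lift _ _ == _]eq_sym !neq_lift.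
case: (unliftP j x) => [x' xE|e]; last by rewrite e eqxx in xj.
case: (unliftP i' x') => [z zE|e]; last by rewrite xE e iE eqxx in xi.
by exists z; rewrite // /f /= -zE.
Qed.

Section FormulasOfDifferentials.
Variables (R : idomainType) (m : nat) (X : 'M[R]_(m.+1, m)) (B : 'M[R]_m.+1).
Hypotheses (m_odd : odd m) (altB : alternating_mx B).

Lemma top_u_formula i :
  top_u X B i = \sum_(j < m.+1 | j != i) (-1) ^+ (i + j) * signed_minor X j * pf_hat B i j.
Proof.
rewrite top_uE /contr mulr_sumr; apply: eq_big => [j|j]; rewrite !inE // => ji.
rewrite setC1D1 /pf_hat.
case: (ltngtP i j) => [lt|lt|/val_inj e]; last by rewrite e eqxx in ji.
  rewrite subpfaffianE // 1?eq_sym // -[in RHS](rank_in_setC1 ji) lt addn1 addnS !exprS exprD.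
  by ring.
rewrite subpfaffianE // [[set j; i]]setUC -[in RHS](rank_in_setC1 ji) ltnNge (ltnW lt) addn0.
by rewrite exprS exprD; ring.
Qed.

Lemma top_v_formula h : top_v X B setT h =
  (-1) ^+ h * \sum_(i < m.+1) \sum_(j < m.+1 | (i < j)%N) minor2 X h i j * pf_hat B i j.
Proof.
rewrite /top_v /pfs_deriv mulr_sumr; apply: eq_big => [i|i _]; first by rewrite inE.
rewrite mulr_sumr; apply: eq_big => [j|j /andP[_ lt]]; first by rewrite inE.
have ij : i != j by rewrite -val_eqE ltn_eqF.
rewrite setTD setC1D1 bordered_minorE // /pf_hat lt subpfaffianE //.
rewrite /rem_sign rank_in_setT setTD.
have := rank_in_setC1 (i := i) (j := j); rewrite eq_sym lt addn1 => /(_ ij) jE.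
have -> : (-1) ^+ (i + j + h).+1 = (-1) ^+ (i + rank_in (~: [set i]) j) * (-1) ^+ h :> R.
  move: (rank_in _ _) jE => r <-.
  by rewrite addnS addSn !exprS !exprD; ring.
by rewrite -!mulrA signrMK.
Qed.

End FormulasOfDifferentials.

(** Every polynomial is congruent to its constant coefficient modulo the
    variables, since this holds for variables and passes to products and sums. *)
Lemma in_irrelevant_ideal (k : comNzRingType) N (p : {mpoly k[N]}) :
  p@_0%MM = 0 -> in_ideal (fun v : 'I_N => 'X_v : {mpoly k[N]}) p.
Proof.
pose P p := exists c : 'I_N -> {mpoly k[N]}, p = (p@_0%MM)%:MP + \sum_v c v * 'X_v.
suff [c cE] : P p by move=> p0; exists c; rewrite {1}cE p0 mpolyC0 add0r.
have PC c : P c%:MP.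
  by exists (fun=> 0); rewrite big1 ?addr0 ?mcoeffC ?eqxx ?mulr1 // => v _; rewrite mul0r.
have PM f g : P f -> P g -> P (f * g).
  case=> c cE [d dE]; exists (fun v => c v * g + (f@_0%MM)%:MP * d v).
  have -> : (f * g)@_0%MM = f@_0%MM * g@_0%MM by rewrite rmorphM.
  under eq_bigr => v _ do rewrite mulrDl -mulrA [g * _]mulrC mulrA -[_ * d v * _]mulrA.
  rewrite big_split /= -mulr_suml -mulr_sumr mpolyCM.
  move: (\sum_v c v * _) (\sum_v d v * _) (f@_0%MM) (g@_0%MM) cE dE => a b f0 g0 -> ->; ring.
have PD f g : P f -> P g -> P (f + g).
  case=> c cE [d dE]; exists (fun v => c v + d v).
  under eq_bigr => v _ do rewrite mulrDl.
  by rewrite big_split mcoeffD mpolyCD {1}cE {1}dE /= addrACA.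
have PX i : P 'X_i.
  exists (fun v => (v == i)%:R); rewrite mcoeffX mnm1_eq0 mpolyC0 add0r.
  rewrite (bigD1 i) //= eqxx mul1r big1 ?addr0 // => v /negPf ->; exact: mul0r.
have P1 : P 1 by rewrite -mpolyC1.
rewrite [p]mpolyE; apply: big_ind => [|//|mm _]; first by rewrite -(mpolyC0 N k).
rewrite -mul_mpolyC; apply: (PM) => //; rewrite mpolyXE_id.
apply: big_ind => // v _; elim: (mm v) => [|d IH]; first by rewrite expr0.
by rewrite exprS; apply: (PM).
Qed.

(** * Acyclicity and minimality *)

Section Acyclicity.
Variables (R : idomainType) (m : nat) (X : 'M[R]_(m.+1, m)) (B : 'M[R]_m.+1).
Hypotheses (m_odd : odd m) (altB : alternating_mx B).
Variables p q a b : 'I_m.+1.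
Local Notation Y := (signed_minor X).
Hypotheses (pf0 : pfs B setT != 0) (Yp : Y p != 0) (Yq : Y q != 0).
Hypotheses (reg_Y : nzd_mod (Y p) (Y q)) (reg_Y_pf : nzd_mod (Y p) (pfs B setT)).
Hypotheses (reg_u_pf : nzd_mod (top_u X B a) (pfs B setT)).
Hypothesis reg_uu_pf : nzd_mod2 (top_u X B b) (top_u X B a) (pfs B setT).
Variables (v3 : 'cV[R]_m.+1) (v2 : 'M[R]_m.+1) (v1 : 'rV[R]_m.+1).
Hypotheses (v3E : v3 = std_v3 X B setT) (v2E : v2 = \matrix_(i, c) std_ef X B i c).
Hypothesis v1E : v1 = \row_i top_u X B i.

Lemma v2_mul (z : 'cV[R]_m.+1) i : (v2 *m z) i 0 =
  - (\sum_h (\sum_j X j h * B i j) * z (lift ord_max h) 0) + Y i * z ord_max 0.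
Proof.
rewrite v2E !mxE sum_lift_max -sumrN !mxE /std_ef unlift_none; congr (_ + _).
by apply: eq_bigr => h _; rewrite !mxE liftK mulNr.
Qed.

Lemma v1_mul (y : 'cV[R]_m.+1) : v1 *m y = (\sum_i top_u X B i * y i 0)%:M.
Proof.
apply/matrixP => r c; rewrite !ord1 v1E !mxE eqxx mulr1n.
by apply: eq_bigr => i _; rewrite !mxE.
Qed.

Lemma top_acyclic : acyclic v3 v2 v1.
Proof.
have lin (T T' : finType) (F : T -> R) (M : T' -> T -> R) (z : T' -> R) :
    \sum_t F t * (\sum_t' M t' t * z t') = \sum_t' (\sum_t M t' t * F t) * z t'.
  under eq_bigr => t _ do rewrite mulr_sumr.
  rewrite exchange_big; apply: eq_bigr => t' _ /=; rewrite mulr_suml.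
  by apply: eq_bigr => t _; ring.
have uB k : \sum_i top_u X B i * B i k = - (Y k * pfs B setT).
  rewrite -(sum_B_u X altB) -sumrN; apply: eq_bigr => i _; rewrite altB.2; ring.
split; first split.
- apply/matrixP => i c; rewrite ord1 v2_mul [RHS]mxE v3E split_col_max.
  under eq_bigr => h _ do rewrite split_col_lift.
  rewrite -(lin _ _ (fun j => B i j) (fun h j => X j h)).
  under eq_bigr => j _ do rewrite sum_X_v //.
  by rewrite sum_B_u // addNr.
- apply/matrixP => r c; rewrite ord1 [RHS]mxE.
  have -> : (v1 *m v2) 0 c = (v1 *m col c v2) 0 0.
    by rewrite !mxE; apply: eq_bigr => i _; rewrite [in RHS]mxE.
  rewrite v1_mul mxE eqxx mulr1n.
  case: (unliftP ord_max c) => [h ->|->]; last first.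
    rewrite -[RHS](sum_Y_u X B); apply: eq_bigr => i _.
    by rewrite v2E !mxE /std_ef unlift_none mulrC.
  have -> : \sum_i top_u X B i * col (lift ord_max h) v2 i 0 =
    - \sum_i top_u X B i * (\sum_j B i j * X j h).
    rewrite -sumrN; apply: eq_bigr => i _; rewrite v2E !mxE /std_ef liftK mulrN.
    by congr (- (_ * _)); apply: eq_bigr => j _; rewrite mulrC.
  rewrite (lin _ _ (top_u X B) (fun j i => B i j) (fun j => X j h)).
  under eq_bigr => j _ do (under eq_bigr => i _ do rewrite mulrC; rewrite uB).
  rewrite (eq_bigr (fun j => - pfs B setT * (Y j * X j h))) => [|j _]; last by ring.
  by rewrite -mulr_sumr signed_minor_mul // mulr0 oppr0.
- move=> z /matrixP/(_ ord_max 0); rewrite !mxE big_ord1 v3E split_col_max => /eqP.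
  rewrite mulf_eq0 (negPf pf0) /= => /eqP z0.
  by apply/matrixP => i c; rewrite !ord1 z0 mxE.
- move=> z vz; have [|c [zE z0]] := @top_exact2 _ _ X B m_odd altB p a pf0 Yp reg_u_pf
     (fun h => z (lift ord_max h) 0) (z ord_max 0).
    by move=> i; rewrite -v2_mul vz mxE.
  exists c%:M; rewrite mul_mx_scalar; apply/matrixP => r c'; rewrite ord1 [RHS]mxE v3E.
  case: (unliftP ord_max r) => [h ->|->]; rewrite ?split_col_lift ?split_col_max ?zE ?z0;
    exact: mulrC.
move=> y; rewrite v1_mul => /matrixP/(_ 0 0); rewrite !mxE eqxx mulr1n => uy.
have [z [z0 yE]] := top_exact1 m_odd altB pf0 Yp Yq reg_Y reg_Y_pf reg_u_pf reg_uu_pf uy.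
exists (split_col z z0); apply/matrixP => i c; rewrite ord1 v2_mul split_col_max yE.
by under [in RHS]eq_bigr => h _ do rewrite split_col_lift.
Qed.

End Acyclicity.

(** At the origin all Pfaffians and minors of positive size vanish, which gives
    minimality. *)
Section ZeroFibre.
Variables (R T : idomainType) (f : {rmorphism R -> T}) (m : nat).
Variables (X : 'M[R]_(m.+1, m)) (B : 'M[R]_m.+1).
Hypotheses (m_ge3 : (3 <= m)%N) (X0 : map_mx f X = 0) (B0 : map_mx f B = 0).

Lemma pfs_zero (I : {set 'I_m.+1}) : (0 < #|I|)%N -> f (pfs B I) = 0.
Proof.
rewrite card_gt0 => /set0Pn[i iI]; rewrite map_pfs B0 (@pfs_isolated _ _ _ _ i) //.
  by split=> *; rewrite !mxE ?oppr0.
by move=> x _; rewrite mxE.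
Qed.

Lemma signed_minor_zero i : f (signed_minor X i) = 0.
Proof.
rewrite map_signed_minor X0 /signed_minor; have -> : row' i (0 : 'M[T]_(m.+1, m)) = 0.
  by apply/matrixP => a b; rewrite !mxE.
have det_zero n : (0 < n)%N -> \det (0 : 'M[T]_n) = 0 by case: n => // n _; rewrite det0.
by rewrite det_zero ?mulr0 // (leq_trans _ m_ge3).
Qed.

End ZeroFibre.

Theorem theorem2p3 (k : fieldType) (s m : nat)
    (s_ge2 : (2 <= s)%N) (nE : m.+1 = s.*2) :
  (exists D : top_data (gen_ring k m) m,
     is_top_data (d3 k m) (d2 k m) (d1 k m) (genB k m) s D) /\
  (forall D : top_data (gen_ring k m) m,
     is_top_data (d3 k m) (d2 k m) (d1 k m) (genB k m) s D ->
     [/\ v1_top D = \row_i u k i,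
         (forall (i : 'I_m.+1) (h : 'I_m),
            v2_top D i (lift ord_max h)
              = - \sum_(j < m.+1) genX k m j h * genB k m i j) /\
         (forall i : 'I_m.+1, v2_top D i ord_max = Y k i),
         (forall h : 'I_m, v3_top s D (lift ord_max h) 0 = v k h) /\
         v3_top s D ord_max 0 = pfaffian (genB k m),
         acyclic (v3_top s D) (v2_top D) (v1_top D)
       & free_resolution_of_quotient (v3_top s D) (v2_top D) (v1_top D)
           (in_ideal (fun i : 'I_m.+1 => u k i)) /\
         minimal (v3_top s D) (v2_top D) (v1_top D)]).
Proof.
have m_odd : odd m by lia.
have m_ge3 : (3 <= m)%N by lia.
pose R : idomainType := {mpoly k[#|gen_var m|]}.
pose X : 'M[R]_(m.+1, m) := genX k m.
pose B : 'M[R]_m.+1 := genB k m.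
have altB : alternating_mx B := genB_alt k m.
have Y0 : signed_minor X ord0 != 0 := gen_Y0_neq0 k nE.
split; first by exists (std_data X B); exact: (std_is_data m_odd altB Y0).
move=> D dataD.
have [efE v3E qE] := is_data_std m_odd altB Y0 s_ge2 nE dataD.
have uE i : u k i = top_u X B i by rewrite top_u_formula.
have vE h : v k h = top_v X B setT h by rewrite top_v_formula.
have v1E : v1_top D = \row_i top_u X B i.
  by apply/matrixP => r i; rewrite !mxE qE top_uE.
have v2E : v2_top D = \matrix_(i, c) std_ef X B i c.
  by apply/matrixP => i c; rewrite !mxE efE.
have ac : acyclic (v3_top s D) (v2_top D) (v1_top D).
  exact (top_acyclic m_odd altB (gen_pf_neq0 k nE) (gen_Ymax_neq0 k nE) Y0
    (@gen_reg_Y k m s nE) (@gen_reg_Y_pf k m s nE) (@gen_reg_u_pf k m s s_ge2 nE)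
    (@gen_reg_uu_pf k m s s_ge2 nE) v3E v2E v1E).
split=> //.
- by rewrite v1E; apply/matrixP => r i; rewrite !mxE uE.
- split=> [i h|i]; rewrite v2E mxE /std_ef ?liftK ?unlift_none //.
- by split=> [h|]; rewrite /v3_top v3E ?split_col_lift ?split_col_max ?vE ?pfaffianE.
split; first split=> //.
  move=> x; split=> [[c ->]|[w]].
    exists (\col_i c i); rewrite (v1_mul v1E); congr (_%:M); apply: eq_bigr => i _.
    by rewrite mxE uE mulrC.
  rewrite (v1_mul v1E) => /matrixP/(_ 0 0); rewrite !mxE eqxx !mulr1n => <-.
  by exists (fun i => w i 0); apply: eq_bigr => i _; rewrite uE mulrC.
(* Minimality is checked by taking constant coefficients. *)
pose f : {rmorphism R -> k} := mcoeff 0%MM.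
have fX : map_mx f X = 0 by apply/matrixP => i j; rewrite !mxE /= mcoeffX mnm1_eq0.
have fb i j : f (b_var k i j) = 0.
  by rewrite /b_var; case: insub => [w|]; rewrite ?rmorph0 //= mcoeffX mnm1_eq0.
have fB : map_mx f B = 0 by apply/matrixP => i j; rewrite !mxE rmorphB !fb subr0.
have fpf (I : {set 'I_m.+1}) : (0 < #|I|)%N -> f (pfs B I) = 0 by exact: pfs_zero fB _.
have fY i : f (signed_minor X i) = 0 by exact: signed_minor_zero.
split=> i j; apply: in_irrelevant_ideal; rewrite -/(f _).
- rewrite ord1 /v3_top v3E split_colE; case: unlift => [h|]; last first.
    by apply: fpf; rewrite cardsT card_ord.
  rewrite /top_v /pfs_deriv rmorph_sum big1 // => i1 _; rewrite rmorph_sum big1 // => i2 _.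
  rewrite rmorphM fpf ?mulr0 //.
  have := cardsD1 i2 (setT :\ i1); have := cardsD1 i1 (setT : {set 'I_m.+1}).
  by rewrite cardsT card_ord in_setT; case: (i2 \in _) => /=; lia.
- rewrite v2E mxE /std_ef; case: unlift => [h|]; last exact: fY.
  rewrite rmorphN rmorph_sum big1 ?oppr0 // => l _.
  by have /matrixP/(_ l h) := fX; rewrite !mxE rmorphM => ->; rewrite mul0r.
rewrite v1E mxE top_uE rmorphM /contr rmorph_sum big1 ?mulr0 // => l _.
by rewrite 2!rmorphM fY mulr0 mul0r.
Qed.
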